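(* Let $K$ be an algebraically closed field of characteristic $0$. Let $h_1,\dots,h_r$ be homogeneous polynomials on $\mathbb{P}^n_K$ of degree strictly less than $d$, and let $h$ be a homogeneous polynomial of degree $d$ such that $V(h)$ has singular locus of dimension $s$, where $s=-1$ if $V(h)$ is smooth. Then the locus where $V(h)$ is tangent to $V(h_1,\dots,h_r)$ has dimension at most $r+s$.
   Context: $V(\cdot)$ denotes the closed subscheme of $\mathbb{P}^n$ cut out by the given homogeneous polynomials. For a homogeneous polynomial $g$ vanishing at a point $p$, let $L_p(g)$ be the linear part of (a local dehomogenization of) $g$ at $p$. $V(h)$ is said to be tangent to $V(h_1,\dots,h_r)$ at a common point $p$ if the Zariski tangent space of $V(h)$ at $p$ contains that of $V(h_1,\dots,h_r)$ at $p$, equivalently if $L_p(h)$ is a linear combination of $L_p(h_1),\dots,L_p(h_r)$. The singular locus of $V(h)$ is the locus where all partial derivatives of $h$ vanish. Dimension $-1$ (or less) means empty. *)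

(* Defs.v *)
From HB Require Import structures.
From mathcomp Require Import all_boot all_order all_algebra.
From mathcomp Require Import generic_quotient mpoly classical_sets.

Set Implicit Arguments.
Unset Strict Implicit.
Unset Printing Implicit Defensive.

Import Order.TTheory GRing.Theory Num.Theory.

Local Open Scope ring_scope.
Local Open Scope quotient_scope.
Local Open Scope classical_set_scope.

Section ProjectiveSpace.
Variables (K : fieldType) (n : nat).

Definition nzvec := {v : 'rV[K]_n.+1 | v != 0}.

(* Two nonzero row vectors have the same row space iff they are proportional;
   see [proportionalP]. *)
Definition proportional (u v : nzvec) : bool := (val u == val v)%MS.

Lemma proportional_refl : reflexive proportional.
Proof. by move=> u; apply/eqmxP. Qed.

Lemma proportional_sym : ssrbool.symmetric proportional.
Proof. by move=> u v; rewrite /proportional andbC. Qed.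

Lemma proportional_trans : transitive proportional.
Proof.
move=> v u w /eqmxP uv /eqmxP vw; apply/eqmxP.
exact: eqmx_trans uv vw.
Qed.

Lemma proportionalP (u v : nzvec) :
  reflect (exists2 c : K, c != 0 & val u = c *: val v) (proportional u v).
Proof.
apply: (iffP idP) => [/andP[/sub_rVP[c uv] _]|[c c0 uv]].
  exists c => //; apply: contraNneq (valP u) => c0.
  by rewrite uv c0 scale0r.
by rewrite /proportional uv; apply/eqmxP/eqmx_scale.
Qed.

Canonical proportional_equiv := EquivRel proportional
  proportional_refl proportional_sym proportional_trans.

Definition proj_space := {eq_quot proportional_equiv}.

Implicit Types (p : proj_space) (g h : {mpoly K[n.+1]}).

(* Homogeneous coordinates of p, normalised by the representative [repr p]. *)
Definition hcoord p : 'I_n.+1 -> K := fun i => val (repr p) 0 i.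

(* The closed points of V(S), for S a set of homogeneous polynomials; the
   choice of homogeneous coordinates is then irrelevant. *)
Definition zlocus (S : set {mpoly K[n.+1]}) : set proj_space :=
  [set p | forall g, S g -> g.@[hcoord p] = 0].

Definition zclosed (Z : set proj_space) : Prop :=
  exists2 S : set {mpoly K[n.+1]},
    (forall g, S g -> exists d : nat, g \is d.-homog) & Z = zlocus S.

(* Irreducibility for the subspace topology on A. *)
Definition zirreducible (A : set proj_space) : Prop :=
  A !=set0 /\
  forall F G, zclosed F -> zclosed G ->
    A `<=` F `|` G -> A `<=` F \/ A `<=` G.

(* Z 0 < Z 1 < ... < Z k is a chain of irreducible relatively closed subsets
   of T; only the values of Z on 0, ..., k matter. *)
Definition irr_chain (T : set proj_space) (k : nat) (Z : nat -> set proj_space)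
    : Prop :=
  (forall i, (i <= k)%N ->
     zirreducible (Z i) /\ exists2 F, zclosed F & Z i = F `&` T) /\
  (forall i, (i < k)%N -> Z i `<` Z i.+1).

(* Krull dimension of T with the subspace topology. As T need not be closed
   this is the usual dimension of a constructible set; the empty set has
   dimension -1. *)
Definition dim_le (T : set proj_space) (m : int) : Prop :=
  -1 <= m /\ forall k Z, irr_chain T k Z -> k%:Z <= m.

Definition dim_eq (T : set proj_space) (m : int) : Prop :=
  dim_le T m /\ (m = -1 \/ exists k Z, irr_chain T k Z /\ k%:Z = m).

Definition singular_locus h : set proj_space :=
  [set p | zlocus [set h] p /\ forall i, (h^`M(i)).@[hcoord p] = 0].

(* Coordinates in the affine chart x_j <> 0 are indexed by 'I_n through
   [lift j] : 'I_n -> 'I_n.+1, which misses exactly j. *)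
Definition dehomog (j : 'I_n.+1) g : {mpoly K[n]} :=
  g \mPo [tuple (if unlift j i is Some k then 'X_k else 1) | i < n.+1].

Definition affcoord (j : 'I_n.+1) p : 'I_n -> K :=
  fun k => hcoord p (lift j k) / hcoord p j.

(* L_p(g): the degree 1 part of the Taylor expansion at p of the
   dehomogenisation of g in the chart x_j <> 0. *)
Definition linear_part (j : 'I_n.+1) p g : {mpoly K[n]} :=
  pihomog mdeg 1
    (dehomog j g \mPo [tuple 'X_k + (affcoord j p k)%:MP | k < n]).

(* Zariski tangent space of V(S) at p, as a subspace of K^n = T_p(A^n). *)
Definition tangent_space (j : 'I_n.+1) p (S : set {mpoly K[n.+1]})
    : set ('I_n -> K) :=
  [set v | forall g, S g -> (linear_part j p g).@[v] = 0].

(* V(h) is tangent to V(S) at their common point p. The inclusion of tangent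
   spaces does not depend on the chart j containing p. *)
Definition tangent_at h (S : set {mpoly K[n.+1]}) p : Prop :=
  exists2 j : 'I_n.+1, hcoord p j != 0 &
    tangent_space j p S `<=` tangent_space j p [set h].

Definition tangency_locus h (S : set {mpoly K[n.+1]}) : set proj_space :=
  [set p | [/\ zlocus [set h] p, zlocus S p & tangent_at h S p]].

End ProjectiveSpace.

(* Main.v *)
Require Import Defs.
From HB Require Import structures.
From mathcomp Require Import all_boot all_order all_algebra.
From mathcomp Require Import generic_quotient mpoly boolp classical_sets.
From mathcomp Require Import zify ring.

(* Let W be the set of pairs (v, a) such that h = sum a_i h_i and grad h = sum a_i grad h_i
   hold at v; the cone over the tangency locus lies in the projection of W to the v-space.
   Noether normalization of the ideal (h, grad h) gives linear forms y_1, ..., y_c such that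
   every monomial of large degree M lies in (h, grad h, y_1, ..., y_c), and lying over produces
   a chain of c primes, so that c <= s + 1.  On W the generators of (h, grad h) are combinations
   of the a_i with coefficients of smaller degree, because deg h_i < d; hence on W the polynomials
   in v of degree at most D are combinations of boundedly many monomials in v with coefficients
   of degree at most D in the r + c functions a_i, y_j.  Counting dimensions, any r + c + 1
   polynomials in v are algebraically dependent on W.  On the other hand a chain of k + 1
   irreducible subsets of the tangency locus gives k + 1 polynomials that are algebraically
   independent on the cone over it, so k + 1 <= r + c <= r + s + 1. *)

Set Implicit Arguments.
Unset Strict Implicit.
Unset Printing Implicit Defensive.

Import Order.TTheory GRing.Theory Num.Theory.

Local Open Scope ring_scope.
Local Open Scope classical_set_scope.

(** * Ideals and primes *)

Record ideal (R : comNzRingType) (I : set R) : Prop := Ideal {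
  ideal0 : I 0;
  idealD : forall x y, I x -> I y -> I (x + y);
  idealMl : forall a x, I x -> I (a * x) }.

Record prime_ideal (R : comNzRingType) (P : set R) : Prop := PrimeIdeal {
  prime_idealW : ideal P;
  prime_ideal1 : ~ P 1;
  prime_idealM : forall x y, P (x * y) -> P x \/ P y }.

Section Ideals.
Variable R : comNzRingType.
Implicit Types (I P S : set R).

Lemma idealMr I : ideal I -> forall a x, I x -> I (x * a).
Proof. by move=> II a x Ix; rewrite mulrC; apply: idealMl. Qed.

Lemma idealN I : ideal I -> forall x, I x -> I (- x).
Proof. by move=> II x Ix; rewrite -mulN1r; apply: idealMl. Qed.

Lemma idealB I : ideal I -> forall x y, I x -> I y -> I (x - y).
Proof. by move=> II x y Ix Iy; apply: idealD => //; apply: idealN. Qed.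

Lemma idealBl I : ideal I -> forall x y, I y -> I (x + y) -> I x.
Proof. by move=> II x y Iy Ixy; rewrite -(addrK y x); apply: idealB. Qed.

Lemma ideal_sum I : ideal I -> forall (J : Type) (r : seq J) (Q : pred J) F,
  (forall j, Q j -> I (F j)) -> I (\sum_(j <- r | Q j) F j).
Proof.
move=> II J r Q F IF; apply: big_ind => //; first exact: ideal0.
exact: idealD.
Qed.

Lemma prime_idealX P : prime_ideal P -> forall x k, P (x ^+ k) -> P x.
Proof.
move=> PP x; elim=> [|k IHk]; first by move/(prime_ideal1 PP).
by rewrite exprS => /(prime_idealM PP)[].
Qed.

Definition adjoin I (x : R) : set R := [set y | exists2 u, I u & exists b, y = u + b * x].

Lemma ideal_adjoin I x : ideal I -> ideal (adjoin I x).
Proof.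
move=> II; split.
- by exists 0; [exact: ideal0 | exists 0; rewrite mul0r addr0].
- move=> _ _ [u Iu [b ->]] [v Iv [c ->]].
  by exists (u + v); [exact: idealD | exists (b + c); ring].
- move=> a _ [u Iu [b ->]].
  by exists (a * u); [exact: idealMl | exists (a * b); ring].
Qed.

Lemma sub_adjoin I x : I `<=` adjoin I x.
Proof. by move=> u Iu; exists u => //; exists 0; rewrite mul0r addr0. Qed.

Lemma mem_adjoin I x : ideal I -> adjoin I x x.
Proof. by move=> II; exists 0; [exact: ideal0 | exists 1; rewrite mul1r add0r]. Qed.

(** An ideal maximal among those containing [I] and avoiding [S] is prime: if [x] and [y] lie
    outside it, adjoining either one yields an element of [S], and the product of these two elements
    lies in it as soon as [x * y] does. *)
Lemma exists_prime_ideal I S : ideal I -> S 1 ->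
    (forall x y, S x -> S y -> S (x * y)) -> (forall x, I x -> ~ S x) ->
  exists P, [/\ prime_ideal P, I `<=` P & forall x, P x -> ~ S x].
Proof.
move=> II S1 SM IS.
pose good X := [/\ ideal X, I `<=` X & forall x, X x -> ~ S x].
(* The empty set satisfies the predicate vacuously, so the union of the empty chain is admissible
   for Zorn's lemma. *)
have [F Fgood totF|A [goodA Amax]] :=
    @Zorn_bigcup R [set X | X !=set0 -> good X].
  move=> [x0 [X0 FX0 X0x0]].
  have gF X : F X -> X !=set0 -> good X by move=> /Fgood; apply.
  have [IX0 IsX0 _] := gF _ FX0 (ex_intro _ _ X0x0).
  split; last first.
  - by move=> x [X FX Xx]; have [_ _] := gF _ FX (ex_intro _ _ Xx); apply.
  - by move=> x Ix; exists X0 => //; apply: IsX0.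
  split; first by exists X0 => //; apply: ideal0.
  - move=> x y [X FX Xx] [Y FY Yy].
    have [IX _ _] := gF _ FX (ex_intro _ _ Xx).
    have [IY _ _] := gF _ FY (ex_intro _ _ Yy).
    have [XY|YX] := totF _ _ FX FY.
      by exists Y => //; apply: idealD => //; apply: XY.
    by exists X => //; apply: idealD => //; apply: YX.
  - move=> a x [X FX Xx]; have [IX _ _] := gF _ FX (ex_intro _ _ Xx).
    by exists X => //; apply: idealMl.
have {}goodA : good A.
  apply: goodA; apply: contrapT => A0; apply: (Amax I).
    split=> [x Ax|IA]; first by case: A0; exists x.
    by apply: A0; exists 0; apply: IA (ideal0 II).
  by move=> _; split.
have [IA IsA SA] := goodA.
have big x : ~ A x -> exists2 s, S s & adjoin A x s.
  move=> nAx; apply: contrapT => H; apply: (Amax (adjoin A x)).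
    by split; [exact: sub_adjoin | move/(_ x (mem_adjoin _ IA))].
  move=> _; split; first exact: ideal_adjoin.
    by move=> y /IsA /(@sub_adjoin A x).
  by move=> y Ay Sy; apply: H; exists y.
exists A; split=> //; split=> //; first by move/SA; apply.
move=> x y Axy; have [|nAx] := pselect (A x); first by left.
have [|nAy] := pselect (A y); first by right.
have [_ [s [Ss [u Au [b sE]]]]] : True /\ exists s, S s /\ adjoin A x s.
  by split=> //; have [s] := big x nAx; exists s.
have [t [St [v Av [c tE]]]] : exists t, S t /\ adjoin A y t.
  by have [t] := big y nAy; exists t.
case: (SA (s * t)); last exact: SM.
have -> : s * t = (v + c * y) * u + (b * x) * v + (b * c) * (x * y).
  by rewrite sE tE; ring.
by apply: idealD => //; [apply: idealD => //|]; apply: idealMl.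
Qed.

End Ideals.

Section RestrictIdeal.
Variables (R R' : comNzRingType) (f : {rmorphism R -> R'}).

Lemma prime_ideal_preimage (P : set R') : prime_ideal P -> prime_ideal (f @^-1` P).
Proof.
move=> PP; have II := prime_idealW PP; split.
- split=> [|x y|a x]; rewrite /preimage /=.
  + by rewrite rmorph0; apply: ideal0.
  + by rewrite rmorphD => Px Py; apply: idealD.
  + by rewrite rmorphM => Px; apply: idealMl.
- by rewrite /preimage /= rmorph1; apply: prime_ideal1.
- by move=> x y; rewrite /preimage /= rmorphM => /(prime_idealM PP).
Qed.

End RestrictIdeal.

(** * Zeros of a prime of A[X] above zeros of its contraction *)

Section PolyPrime.
Variables (A : idomainType) (P : set {poly A}).
Hypothesis PP : prime_ideal P.

Let PI := prime_idealW PP.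
Let P0 : set A := [set c | P c%:P].
(** The extension to A[X] of the contraction [P0]: the polynomials that are zero modulo [P0]. *)
Let P0X : set {poly A} := [set q | forall i, P0 q`_i].

Let P0_prime : prime_ideal P0.
Proof. exact: (@prime_ideal_preimage _ _ polyC). Qed.

Let P0I := prime_idealW P0_prime.

Let P0X_ideal : ideal P0X.
Proof.
split=> [i|p q Pp Pq i|p q Pq i].
- by rewrite coef0; apply: ideal0 P0I.
- by rewrite coefD; apply: idealD P0I _ _ _ _.
- rewrite coefM; apply: (ideal_sum P0I) => j _.
  exact: idealMl P0I _ _ (Pq _).
Qed.

Let P0X_sub : P0X `<=` P.
Proof.
move=> q Pq; rewrite -[q]coefK poly_def; apply: (ideal_sum PI) => i _.
by rewrite -mul_polyC; apply: idealMr => //; apply: Pq.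
Qed.

Let exists_min (J : set {poly A}) f : J f -> ~ P0X f ->
  exists t, [/\ J t, ~ P0X t & forall q, J q -> (size q < size t)%N -> P0X q].
Proof.
move: {2}(size f) (leqnn (size f)) => k; elim: k f => [|k IHk] f fk Jf nf.
  by case: nf; move: fk; rewrite leqn0 size_poly_eq0 => /eqP ->; apply: ideal0.
have [[g [Jg ng gf]]|H] := pselect (exists g, [/\ J g, ~ P0X g & (size g < size f)%N]).
  by apply: (IHk g) => //; rewrite -ltnS; apply: leq_trans gf fk.
by exists f; split=> // q Jq qf; apply: contrapT => nq; apply: H; exists q.
Qed.

(** Otherwise the leading term lies in [P0X], and removing it leaves a shorter element of [J]
    outside [P0X]. *)
Let lead_min (J : set {poly A}) t : ideal J -> P `<=` J -> J t -> ~ P0X t ->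
  (forall q, J q -> (size q < size t)%N -> P0X q) -> ~ P0 (lead_coef t).
Proof.
move=> IJ PJ Jt nt tmin Pl.
pose l := (lead_coef t)%:P * 'X^((size t).-1).
have Xl : P0X l.
  by move=> i; rewrite coefCM; apply: idealMr.
have t0 : t != 0 by apply/eqP => t0; case: nt; rewrite t0; apply: ideal0.
case: nt; rewrite -[t](subrK l); apply: (idealD P0X_ideal) => //.
apply: tmin; first by apply: idealB => //; apply/PJ/P0X_sub.
rewrite (polySpred t0) ltnS; apply/leq_sizeP => j jt.
rewrite coefB coefCM coefXn; case: eqP => [->|/eqP jn].
  by rewrite mulr1 subrr.
rewrite mulr0 subr0; apply: (leq_sizeP _ _ (leqnn _)).
by rewrite (polySpred t0) ltn_neqAle eq_sym jn.
Qed.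

(** In pseudo-division by [t] the remainder stays in [J] and is shorter than [t], so minimality of
    [t] puts it in [P0X]. *)
Let pseudo_div (J : set {poly A}) t : ideal J -> J t -> ~ P0X t ->
    (forall q, J q -> (size q < size t)%N -> P0X q) ->
  forall q, J q -> exists N s r,
    [/\ (lead_coef t ^+ N)%:P * q = s * t + r, P0X r & (size r < size t)%N].
Proof.
move=> IJ Jt nt tmin q Jq.
have t0 : t != 0 by apply/eqP => t0; case: nt; rewrite t0; apply: ideal0.
have E := Pdiv.ComRing.rdivp_eq t q.
exists (Pdiv.Ring.rscalp q t), (Pdiv.Ring.rdivp q t), (Pdiv.Ring.rmodp q t).
have sr : (size (Pdiv.Ring.rmodp q t) < size t)%N by rewrite Pdiv.Ring.ltn_rmodp.
rewrite mul_polyC E; split=> //; apply: tmin => //.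
have -> : Pdiv.Ring.rmodp q t =
    lead_coef t ^+ Pdiv.Ring.rscalp q t *: q - Pdiv.Ring.rdivp q t * t.
  by rewrite E addrC addKr.
by apply: idealB => //; [rewrite -mul_polyC|]; apply: idealMl.
Qed.

(* Over the fraction field of A modulo the contraction of P, the extension of P is either zero
   or generated by an irreducible f coprime to g; in the second case [u] is the leading
   coefficient of f times a constant of the ideal (P, g). *)
Lemma prime_ideal_extension (K : closedFieldType) (g : {poly A}) : ~ P g ->
  exists2 u, ~ P u%:P & forall ev : {rmorphism A -> K},
    (forall c, P c%:P -> ev c = 0) -> ev u != 0 ->
    exists2 b, (forall q, P q -> (map_poly ev q).[b] = 0) &
               (map_poly ev g).[b] != 0.
Proof.
move=> nPg.
have evX (ev : {rmorphism A -> K}) : (forall c, P c%:P -> ev c = 0) ->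
    forall q, P0X q -> map_poly ev q = 0.
  by move=> ev0 q Xq; apply/polyP => i; rewrite coef0 coef_map /= ev0 //; apply: Xq.
have [PX|nPX] := pselect (forall q, P q -> P0X q).
  have /existsNP[i ngi] : ~ P0X g by move/P0X_sub.
  exists g`_i => // ev ev0 gi; have gn0 : map_poly ev g != 0.
    by apply/eqP => /polyP/(_ i); rewrite coef0 coef_map /=; apply/eqP.
  have [b nb] := closed_nonrootP _ gn0; exists b; last exact: nb.
  by move=> q /PX/(evX _ ev0) ->; rewrite horner0.
have [f0 [Pf0 nf0]] : exists q, P q /\ ~ P0X q.
  by apply: contrapT => H; apply: nPX => q Pq; apply: contrapT => nq; apply: H; exists q.
have [f [Pf nf fmin]] := exists_min Pf0 nf0.
have PJ : P `<=` adjoin P g by apply: sub_adjoin.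
have IJ := ideal_adjoin g PI.
have [t [Jt nt tmin]] := exists_min (PJ _ Pf) nf.
have le := lead_min PI (@subset_refl _ P) Pf nf fmin.
have lu := lead_min IJ PJ Jt nt tmin.
have nX N : ~ P0 (lead_coef t ^+ N) by move/(prime_idealX P0_prime).
(* Pseudo-dividing [f] by [t] puts [s * t] in [P]. If [t] were in [P], so would be [g]. Hence [s] is
   in [P] but not in [P0X], its degree is at least that of [f], and only degree 0 is left for
   [t]. *)
have st : size t = 1%N.
  have [N [s [r [E Xr rt]]]] := pseudo_div IJ Jt nt tmin (PJ _ Pf).
  have Pst : P (s * t).
    by apply: (idealBl PI (y := r)); [apply: P0X_sub | rewrite -E; apply: idealMl].
  case: (prime_idealM PP Pst) => [Ps|Pt]; last first.
    have [N' [s' [r' [E' Xr' _]]]] := pseudo_div IJ Jt nt tmin (mem_adjoin g PI).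
    have : P ((lead_coef t ^+ N')%:P * g).
      by rewrite E'; apply: (idealD PI); [apply: idealMl|apply: P0X_sub].
    by move/(prime_idealM PP) => [/nX|].
  have [Xs|nXs] := pselect (P0X s).
    exfalso; have : P0X ((lead_coef t ^+ N)%:P * f).
      by rewrite E; apply: (idealD P0X_ideal) => //; apply: (idealMr P0X_ideal).
    move/(_ (size f).-1); rewrite coefCM => /(prime_idealM P0_prime)[/nX|] //.
  have sf : (size f <= size s)%N.
    by rewrite leqNgt; apply/negP => sf; apply: nXs; apply: fmin.
  have s0 : s != 0 by apply/eqP => s0; case: nXs; rewrite s0; apply: ideal0.
  have t0 : t != 0 by apply/eqP => t0; case: nt; rewrite t0; apply: ideal0.
  have : (size (s * t)%R <= maxn (size f) (size r))%N.
    have -> : s * t = (lead_coef t ^+ N)%:P * f - r by rewrite E addrK.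
    apply: leq_trans (size_polyD _ _) _; rewrite size_polyN geq_max leq_maxr andbT.
    by rewrite (leq_trans _ (leq_maxl _ _)) // mul_polyC size_scale_leq.
  rewrite size_mul //; have := size_poly_eq0 t; rewrite (negbTE t0).
  have := size_poly_eq0 s; rewrite (negbTE s0).
  move: sf rt; set a := size s; set b := size t; set c := size f; set d := size r.
  lia.
have tE := size1_polyC (eq_leq st).
have lt : lead_coef t = t`_0 by rewrite lead_coefE st.
exists (lead_coef f * t`_0).
  by rewrite polyCM => /(prime_idealM PP)[/le|]; rewrite -?lt.
move=> ev ev0; rewrite rmorphM mulf_eq0 negb_or => /andP[ef et].
have sf : (1 < size f)%N.
  rewrite ltnNge; apply/negP => sf; apply: nf => i; rewrite (size1_polyC sf) coefC.
  case: eqP => _; last exact: ideal0 P0I.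
  by rewrite /P0 /= -(size1_polyC sf).
have smf : size (map_poly ev f) = size f by rewrite size_map_poly_id0.
have [b rb] : exists b, root (map_poly ev f) b.
  by apply/closed_rootP; rewrite smf; case: (size f) sf => [|[]].
(* Up to a power of its leading coefficient, which [ev] does not kill, [f] divides [q] modulo
   [P0X]. *)
have zero q : P q -> (map_poly ev q).[b] = 0.
  move=> Pq; have [N [s [r [E Xr _]]]] := pseudo_div PI Pf nf fmin Pq.
  have := congr1 (fun p => (map_poly ev p).[b]) E.
  rewrite rmorphD !rmorphM /= (evX _ ev0 _ Xr) addr0 hornerM [in RHS]hornerM.
  rewrite (rootP rb) mulr0 map_polyC hornerC /= rmorphXn /= => /eqP.
  by rewrite mulf_eq0 expf_eq0 (negbTE ef) andbF => /eqP.
exists b => //; apply/eqP => gb.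
(* The constant [t] is [p + w * g] with [p] in [P]; if [g] vanished at [b], then [ev] would kill
   [t]. *)
case: Jt => p Pp [w tw]; move: et; rewrite -[ev _](hornerC _ b) -map_polyC -tE tw.
by rewrite rmorphD rmorphM hornerD hornerM gb mulr0 addr0 (zero _ Pp) eqxx.
Qed.

End PolyPrime.

(** * The Nullstellensatz and independence along chains of primes *)

Section MPolyMorphisms.
Variables (K : comNzRingType) (S : comNzRingType).

Lemma mpoly_rmorph_eq n (f g : {rmorphism {mpoly K[n]} -> S}) :
  (forall c, f c%:MP = g c%:MP) -> (forall i, f 'X_i = g 'X_i) -> f =1 g.
Proof.
move=> fgC fgX; elim/mpolyind => [|c m p _ _ IHp]; first by rewrite !rmorph0.
rewrite !rmorphD /= IHp -mul_mpolyC !rmorphM /= fgC; congr (_ * _ + _).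
rewrite mpolyXE_id !rmorph_prod /=; apply: eq_bigr => i _.
by rewrite !rmorphXn /= fgX.
Qed.

Lemma muni_widen n (i : 'I_n) : muni ('X_(widen_ord (leqnSn n) i) : {mpoly K[n.+1]}) = ('X_i)%:P.
Proof.
rewrite muniE msuppX big_seq1 mcoeffX eqxx scale1r mnm1E -val_eqE /= ltn_eqF //.
rewrite expr0 alg_polyC; congr ('X_[_])%:P; apply/mnmP => j.
by rewrite mnmE !mnm1E -!val_eqE.
Qed.

Lemma muni_max n : muni ('X_ord_max : {mpoly K[n.+1]}) = 'X.
Proof.
rewrite muniE msuppX big_seq1 mcoeffX eqxx scale1r mnm1E eqxx expr1.
have -> : [multinom (U_(ord_max)%MM (widen_ord (leqnSn n) i)) | i < n] = 0%MM :> 'X_{1..n}.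
  by apply/mnmP => j; rewrite mnmE mnm1E mnm0E -val_eqE /= gtn_eqF.
by rewrite mpolyX0 scale1r.
Qed.

(** With [p] seen as a univariate polynomial in the last variable, inductions on the number of
    variables can pass through A[X]. *)
Lemma muni_rmorph n (f : {rmorphism {mpoly K[n.+1]} -> S}) p :
  f p = (map_poly (f \o @mwiden n K) (muni p)).[f 'X_ord_max].
Proof.
pose g : {rmorphism {mpoly K[n.+1]} -> S} :=
  horner_eval (f 'X_ord_max) \o map_poly (f \o @mwiden n K) \o @muni n K.
rewrite -[RHS]/(g p); apply: mpoly_rmorph_eq => [c|i] /=.
  by rewrite muniC map_polyC /horner_eval hornerC /= mwidenC.
rewrite /horner_eval; case: (unliftP ord_max i) => [j ->|->]; last first.
  by rewrite muni_max map_polyX hornerX.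
have -> : lift ord_max j = widen_ord (leqnSn n) j by apply: val_inj;
  rewrite /= /bump leqNgt ltn_ord.
by rewrite muni_widen map_polyC hornerC /= mwidenX mnmwiden1.
Qed.

End MPolyMorphisms.

Lemma muniK (K : comNzRingType) n (p : {mpoly K[n.+1]}) :
  (map_poly (@mwiden n K) (muni p)).['X_ord_max] = p.
Proof. by rewrite [RHS](muni_rmorph idfun) /=; congr (_.[_]); apply: eq_map_poly. Qed.

(** Induction on the number of variables: the contraction of [P] has a zero where the [u] of
    [prime_ideal_extension] does not vanish, and that lemma supplies the last coordinate. Without
    variables, [P] contains no nonzero constant. *)
Theorem nullstellensatz (K : closedFieldType) n (P : set {mpoly K[n]}) g :
    prime_ideal P -> ~ P g ->
  exists2 a : 'I_n -> K, (forall f, P f -> f.@[a] = 0) & g.@[a] != 0.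
Proof.
elim: n P g => [|n IHn] P g PP nPg.
  have PC c : P c%:MP -> c = 0.
    move=> Pc; apply: contrapT => /eqP c0; apply: (prime_ideal1 PP).
    rewrite -mpolyC1 -(mulVf c0) mpolyCM; exact: idealMl (prime_idealW PP) _ _ _.
  exists (fun=> 0) => [f|].
    by rewrite [f]nvar0_mpolyC => /PC ->; rewrite mevalC.
  rewrite [g]nvar0_mpolyC mevalC; apply/eqP => g0; apply: nPg.
  by rewrite [g]nvar0_mpolyC g0; apply: ideal0 (prime_idealW PP).
pose f : {rmorphism {poly {mpoly K[n]}} -> {mpoly K[n.+1]}} :=
  horner_eval 'X_ord_max \o map_poly (@mwiden n K).
have fK p : f (muni p) = p by rewrite -[RHS]muniK.
pose Q := f @^-1` P.
have QP : prime_ideal Q by exact: prime_ideal_preimage.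
have nQg : ~ Q (muni g) by rewrite /Q /preimage /= -[X in P X]/(f (muni g)) fK.
have [u nQu Hu] := prime_ideal_extension QP K nQg.
have [a a0 au] := IHn _ _ (@prime_ideal_preimage _ _ polyC _ QP) nQu.
have [b b0 bg] := Hu (meval a) a0 au.
pose ab i := if unlift ord_max i is Some j then a j else b.
have abE p : p.@[ab] = (map_poly (meval a) (muni p)).[b].
  rewrite -[LHS]/(meval ab p) muni_rmorph /= mevalXU {2}/ab unlift_none; congr (_.[_]).
  apply: eq_map_poly; apply: mpoly_rmorph_eq => [c|i] /=; first by rewrite mwidenC !mevalC.
  rewrite mwidenX mnmwiden1 !mevalXU.
  have -> : widen_ord (leqnSn n) i = lift ord_max i
    by apply: val_inj; rewrite /= /bump leqNgt ltn_ord.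
  by rewrite /ab liftK.
exists ab => [p Pp|]; rewrite abE //; apply: b0.
by rewrite /Q /preimage /= -[X in P X]/(f (muni p)) fK.
Qed.

(** Let [x] be the image of the last variable. If a polynomial in [x] lies in the smallest prime,
    its constant term lies in the next one, which contains [x], so it is 0 by induction; then [x]
    can be divided out, being outside the smallest prime. *)
Lemma prime_chain_independent (K : fieldType) (B : comNzRingType) m
    (f : {rmorphism {mpoly K[m]} -> B}) (P : nat -> set B) :
  (forall i, (i <= m)%N -> prime_ideal (P i)) ->
  (forall i, (i < m)%N -> P i.+1 `<=` P i) ->
  (forall i : 'I_m, P i (f 'X_i) /\ ~ P i.+1 (f 'X_i)) ->
  forall p, P m (f p) -> p = 0.
Proof.
elim: m f => [|m IHm] f PP Psub fX p.
  rewrite [p]nvar0_mpolyC => Pp; apply/eqP; rewrite mpolyC_eq0.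
  apply: contrapT => /negP p0; apply: (prime_ideal1 (PP 0%N isT)).
  rewrite -(rmorph1 f) -mpolyC1 -(mulVf p0) mpolyCM rmorphM.
  exact: idealMl (prime_idealW (PP 0%N isT)) _ _ _.
have PPm := PP m.+1 (leqnn _); have PPm' := PP m (leqnSn _).
have [Px nPx] := fX ord_max.
have key (q : {poly {mpoly K[m]}}) :
    P m.+1 (map_poly (f \o @mwiden m K) q).[f 'X_ord_max] -> q = 0.
  elim/poly_ind: q => // q c IHq.
  rewrite rmorphD rmorphM /= map_polyX map_polyC /= !hornerE => Pqc.
  have c0 : c = 0.
    apply: (IHm (f \o @mwiden m K)).
    - by move=> i im; apply: PP; apply: leqW.
    - by move=> i im; apply: Psub; apply: leqW.
    - move=> i /=; rewrite mwidenX mnmwiden1.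
      by have := fX (widen_ord (leqnSn m) i).
    - move: Pqc => /(Psub m (leqnn _)); rewrite addrC => Pqc;
      apply: (idealBl (prime_idealW PPm') _ Pqc).
      exact: idealMl (prime_idealW PPm') _ _ _.
  move: Pqc; rewrite c0 !rmorph0 addr0 => /(prime_idealM PPm)[/IHq ->|//].
  by rewrite mul0r addr0.
by rewrite muni_rmorph => /key p0; rewrite -[p]muniK p0 rmorph0 horner0.
Qed.

(** * Expansions over few parameters *)

Lemma exists_submonomial n (m : 'X_{1..n}) k : (k <= mdeg m)%N ->
  exists2 m1 : 'X_{1..n}, mdeg m1 = k & (m1 <= m)%MM.
Proof.
elim: k => [|k IHk] km; first by exists 0%MM; [exact: mdeg0 | by apply/mnm_lepP => i;
  rewrite mnm0E].
have [m1 m1k m1m] := IHk (ltnW km).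
have [i mi|mi] := pickP (fun i => m1 i < m i)%N; last first.
  suff mm1 : m = m1 by move: km; rewrite mm1 m1k ltnn.
  apply/mnmP => i; apply/eqP; rewrite eqn_leq leqNgt mi /=.
  by move/mnm_lepP: m1m.
exists (m1 + U_(i))%MM; first by rewrite mdegD mdeg1 m1k addn1.
apply/mnm_lepP => j; rewrite mnmDE mnm1E; have /mnm_lepP/(_ j) := m1m.
by case: eqP => [<-|_]; rewrite ?addn1 ?addn0.
Qed.

Lemma msize_mulX (K : idomainType) n (p : {mpoly K[n]}) m k :
  (msize p <= k)%N -> (msize (p * 'X_[m]) <= k + mdeg m)%N.
Proof.
move=> pk; have [->|p0] := eqVneq p 0; first by rewrite mul0r msize0.
by rewrite msizeM ?msizeX ?addnS ?leq_add2r // -(mmeasure_poly_eq0 mdeg) msizeX.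
Qed.

Lemma msize_prod_le (K : idomainType) n (I : finType) (f : I -> {mpoly K[n]}) e :
  (forall i, msize (f i) <= (e i).+1)%N ->
  (msize (\prod_i f i) <= (\sum_i e i).+1)%N.
Proof.
move=> fe; elim/big_ind2: _ => [|a p b q ap bq|i _]; [by rewrite msize1| |exact: fe].
have [->|p0] := eqVneq p 0; first by rewrite mul0r msize0.
have [->|q0] := eqVneq q 0; first by rewrite mulr0 msize0.
by rewrite msizeM //; move: (msize p) (msize q) ap bq => c d; lia.
Qed.

Lemma msize_exp_le (K : idomainType) n (p : {mpoly K[n]}) e k :
  (msize p <= e.+1)%N -> (msize (p ^+ k) <= (e * k).+1)%N.
Proof.
move=> pe; have := msize_prod_le (fun _ : 'I_k => pe).
by rewrite prodr_const sum_nat_const card_ord mulnC.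
Qed.

Lemma card_bmultinom_le n D : (#|{: 'X_{1..n < D}}| <= D ^ n)%N.
Proof.
have mD (m : 'X_{1..n < D}) (i : 'I_n) : (m i < D)%N.
  by apply: leq_ltn_trans (bmdeg m); rewrite mdegE (bigD1 i) //= leq_addr.
pose f (m : 'X_{1..n < D}) : {ffun 'I_n -> 'I_D} := [ffun i => Ordinal (mD m i)].
rewrite -[X in (_ <= X ^ _)%N]card_ord -[X in (_ <= _ ^ X)%N]card_ord -card_ffun.
rewrite -(card_codom (f := f)) ?max_card // => m1 m2 /ffunP f12.
apply/val_inj/mnmP => i; have := f12 i; rewrite !ffunE.
by move/(congr1 val).
Qed.

(* [v] and [z] are families of functions on [Om]; modulo the relations holding on [Om],
   the algebra generated by [v] is spanned by low-degree monomials over the one generated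
   by [z]. *)
Section Reduction.
Variables (K : fieldType) (n N : nat) (Om : Type).
Variables (v : Om -> 'I_n -> K) (z : Om -> 'I_N -> K) (M : nat).
Hypothesis reduce : forall m : 'X_{1..n}, mdeg m = M ->
  exists2 g : 'I_N -> {mpoly K[n]}, (forall l, msize (g l) <= M)%N &
    forall w, 'X_[m].@[v w] = \sum_l z w l * (g l).@[v w].

(** [D] bounds the size of the coefficients in [z], whose degree is thus below [D]; the monomials in
    [v] always have degree below [M]. *)
Definition expands (F : Om -> K) D :=
  exists2 u : 'X_{1..n < M} -> {mpoly K[N]}, (forall m, msize (u m) <= D)%N &
    forall w, F w = \sum_(m : 'X_{1..n < M}) (u m).@[z w] * 'X_[m].@[v w].

Lemma expands_ext F G D : F =1 G -> expands F D -> expands G D.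
Proof. by move=> FG [u uD uF]; exists u => // w; rewrite -FG. Qed.

Lemma expandsZ F D c : expands F D -> expands (fun w => c * F w) D.
Proof.
move=> [u uD uF]; exists (fun m => c *: u m) => [m|w].
  exact: leq_trans (msizeZ_le _ _) (uD m).
by rewrite uF mulr_sumr; apply: eq_bigr => m _; rewrite mevalZ mulrA.
Qed.

Lemma expands_sum (J : Type) (r : seq J) (F : J -> Om -> K) D :
  (forall j, expands (F j) D) -> expands (fun w => \sum_(j <- r) F j w) D.
Proof.
move=> FD; elim: r => [|j r [u2 s2 e2]].
  exists (fun=> 0) => [m|w]; first by rewrite msize0.
  by rewrite big_nil big1 // => m _; rewrite meval0 mul0r.
have [u1 s1 e1] := FD j.
exists (fun m => u1 m + u2 m) => [m|w].
  by rewrite (leq_trans (mmeasureD_le _ _ _)) // geq_max s1 s2.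
rewrite big_cons e1 e2 -big_split; apply: eq_bigr => m _.
by rewrite mevalD mulrDl.
Qed.

Lemma expandsMz F D l : expands F D -> expands (fun w => z w l * F w) D.+1.
Proof.
move=> [u uD uF]; exists (fun m => u m * 'X_l) => [m|w].
  by apply: leq_trans (msize_mulX _ (uD m)) _; rewrite mdeg1 addn1.
rewrite uF mulr_sumr; apply: eq_bigr => m _.
by rewrite mevalM mevalXU mulrA (mulrC (z w l)).
Qed.

(** Splitting a factor of degree [M] off a long monomial and applying [reduce] lowers the degree in
    [v] by at least one, at the price of one factor [z w l]. *)
Lemma expands_mpoly g D : (msize g <= D)%N -> expands (fun w => g.@[v w]) D.
Proof.
elim: D g => [|D IHD] g gD.
  move: gD; rewrite leqn0 mmeasure_poly_eq0 => /eqP ->.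
  by exists (fun=> 0) => [m|w]; rewrite ?msize0 // meval0 big1 // => m _; rewrite meval0 mul0r.
suff EX m : (mdeg m <= D)%N -> expands (fun w => 'X_[m].@[v w]) D.+1.
  apply: (@expands_ext (fun w => \sum_j _ j w) _ _ _ (expands_sum (index_enum _)
    (F := fun (m : 'X_{1..n < D.+1}) w => g@_m * 'X_[m].@[v w]) _)) => [w|m].
    by rewrite {2}[g](mpolywE gD) rmorph_sum; apply: eq_bigr => m _; rewrite /= mevalZ.
  by apply/expandsZ/EX; rewrite -ltnS bmdeg.
move=> mD; have [Mm|mM] := leqP M (mdeg m); last first.
  exists (fun m' => ((BMultinom mM) == m')%:R) => [m'|w].
    by case: eqP; rewrite ?msize1 ?msize0.
  rewrite (bigD1 (BMultinom mM)) //= eqxx rmorph1 mul1r big1 ?addr0 // => m' m'm.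
  by rewrite eq_sym (negbTE m'm) rmorph0 mul0r.
have [m1 m1M m1m] := exists_submonomial Mm.
have [g1 g1M g1E] := reduce m1M.
apply: (@expands_ext (fun w => \sum_j _ j w) _ _ _ (expands_sum (index_enum _)
  (F := fun l w => z w l * (g1 l * 'X_[m - m1]).@[v w]) _)) => [w|l].
  rewrite -[in RHS](submK m1m) addmC mpolyXD mevalM g1E mulr_suml.
  by apply: eq_bigr => l _; rewrite mevalM mulrA.
apply/expandsMz/IHD/(leq_trans (msize_mulX _ (g1M l))).
by rewrite -{1}m1M -mdegD addmC submK.
Qed.

(** Linear algebra: the products of powers of the [f i] with exponents at most [L] number
    [L.+1 ^ m], while their expansions have only O([L ^ N]) coefficients. *)
Lemma reduction_algebraic m (f : 'I_m -> {mpoly K[n]}) : (N < m)%N ->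
  exists2 Q : {mpoly K[m]}, Q != 0 & forall w, Q.@[fun i => (f i).@[v w]] = 0.
Proof.
move=> Nm; pose e := \max_i msize (f i).
(* This [L] makes [A * D ^ N <= L * L.+1 ^ N < L.+1 ^ N.+1], since [D <= (e * m + 1) * L.+1]. *)
pose A := #|{: 'X_{1..n < M}}|; pose L := (A * (e * m + 1) ^ N)%N.
pose D := (e * m * L).+1.
pose T := {ffun 'I_m -> 'I_L.+1}.
pose F (b : T) := \prod_i f i ^+ b i.
have FD b : (msize (F b) <= D)%N.
  apply: leq_trans (msize_prod_le (e := fun i => e * b i)%N _) _ => [i|].
    by apply: msize_exp_le; apply: leqW; exact: leq_bigmax.
  rewrite ltnS -big_distrr /= -mulnA leq_mul2l; apply/orP; right.
  rewrite -[X in (_ <= X * _)%N]card_ord -sum_nat_const; apply: leq_sum => i _.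
  by rewrite -ltnS.
have /choice[u uP] b : exists u : 'X_{1..n < M} -> {mpoly K[N]},
    (forall m, msize (u m) <= D)%N /\
    forall w, (F b).@[v w] = \sum_(m : 'X_{1..n < M}) (u m).@[z w] * 'X_[m].@[v w].
  by have [u] := expands_mpoly (FD b); exists u.
pose C := ('X_{1..n < M} * 'X_{1..N < D})%type.
(* Row [b] lists the coefficients of the expansion of [F b]; a vector of the left kernel gives the
   coefficients of [Q]. *)
pose U := \matrix_(i < #|{: T}|, j < #|{: C}|)
  (u (enum_val i) (enum_val j).1)@_((enum_val j).2).
have rkU : kermx U != 0.
  rewrite kermx_eq0 /row_free neq_ltn; apply/orP; left.
  apply: leq_ltn_trans (rank_leq_col _) _; rewrite card_prod card_ffun !card_ord.
  apply: leq_ltn_trans (leq_mul (leqnn A) (card_bmultinom_le N D)) _.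
  have DL : (D <= (e * m + 1) * L.+1)%N by rewrite /D; nia.
  have : (A * D ^ N <= L * L.+1 ^ N)%N.
    rewrite {1}/L -mulnA leq_mul2l -expnMn; apply/orP; right.
    by have [->|N0] := posnP N; rewrite ?expn0 ?leq_exp2r.
  move/leq_ltn_trans; apply; apply: leq_trans (leq_pexp2l _ Nm) => //.
  by rewrite expnS ltn_mul2r expn_gt0 /= ltnS leqnn.
have [l /sub_kermxP lU l0] := rowV0Pn rkU.
pose mon (b : T) : 'X_{1..m} := [multinom (b i : nat) | i < m].
exists (\sum_(i < #|{: T}|) l 0 i *: 'X_[mon (enum_val i)]).
  have [i li] : exists i, l 0 i != 0.
    apply/existsP; apply: contraNT l0; rewrite negb_exists => /forallP l0.
    by apply/eqP/rowP => i; rewrite mxE; apply/eqP; rewrite -[_ == _]negbK l0.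
  apply: contraNneq li => /(congr1 (mcoeff (mon (enum_val i)))).
  rewrite mcoeff0 raddf_sum /= (bigD1 i) //= mcoeffZ mcoeffX eqxx mulr1.
  rewrite big1 ?addr0 => [->//|j ji]; rewrite mcoeffZ mcoeffX.
  case: eqP => [/mnmP E|]; last by rewrite mulr0.
  case/eqP: ji; apply: enum_val_inj; apply/ffunP => k; apply: val_inj.
  by have := E k; rewrite !mnmE.
move=> w; rewrite rmorph_sum /=.
transitivity (\sum_(c : C) (\sum_i l 0 i * (u (enum_val i) c.1)@_c.2) *
    ('X_[c.2].@[z w] * 'X_[c.1].@[v w])).
  rewrite (eq_bigr (fun i => \sum_(c : C) (l 0 i * (u (enum_val i) c.1)@_c.2) *
    ('X_[c.2].@[z w] * 'X_[c.1].@[v w]))); last first.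
    move=> i _; rewrite mevalZ mevalX.
    have -> : \prod_j (f j).@[v w] ^+ mon (enum_val i) j = (F (enum_val i)).@[v w].
      by rewrite rmorph_prod; apply: eq_bigr => j _; rewrite mnmE rmorphXn.
    rewrite (uP _).2 mulr_sumr -(pair_bigA _ (fun (c : 'X_{1..n < M}) (d :
      'X_{1..N < D}) => l 0 i *
      (u (enum_val i) c)@_d * ('X_[d].@[z w] * 'X_[c].@[v w]))) /=.
    apply: eq_bigr => c _; rewrite {1}[u _ _](mpolywE ((uP _).1 _)) rmorph_sum /=.
    rewrite mulr_suml mulr_sumr; apply: eq_bigr => d _.
    by rewrite mevalZ -!mulrA.
  by rewrite exchange_big; apply: eq_bigr => c _; rewrite mulr_suml.
rewrite big1 // => c _; have /rowP/(_ (enum_rank c)) := lU.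
rewrite !mxE => E; rewrite [X in X * _](_ : _ = 0) ?mul0r // -[RHS]E.
by apply: eq_bigr => i _; rewrite mxE enum_rankK.
Qed.

(** The determinant trick: multiplication by [b] acts on the monomials of degree below [M] through a
    matrix over the polynomials in [z], and [b] is a root of its characteristic polynomial. *)
Lemma reduction_integral (b : {mpoly K[n]}) : (0 < M)%N ->
  exists2 p : {poly {mpoly K[N]}}, p \is monic &
    forall w, root (map_poly (meval (z w)) p) b.@[v w].
Proof.
move=> M0; pose T := 'X_{1..n < M}.
have /choice[u uP] (m : T) : exists u : T -> {mpoly K[N]},
    forall w, (b * 'X_[m]).@[v w] = \sum_m (u m).@[z w] * 'X_[m].@[v w].
  by have [u] := expands_mpoly (leqnn (msize (b * 'X_[m]))); exists u.
pose U := \matrix_(i < #|{: T}|, j < #|{: T}|) u (enum_val j) (enum_val i).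
exists (char_poly U); first exact: char_poly_monic.
move=> w; rewrite map_char_poly -eigenvalue_root_char; apply/eigenvalueP.
exists (\row_(i < #|{: T}|) 'X_[(enum_val i : T)].@[v w]).
  apply/rowP => j; rewrite !mxE -mulrC -mevalM mulrC uP.
  rewrite [RHS](reindex_onto (enum_val (A := {: T})) enum_rank) /=; last first.
    by move=> m _; apply: enum_rankK.
  by apply: eq_big => i; rewrite ?enum_valK ?eqxx // !mxE mulrC.
(* As [0 < M], the monomial 1 is a coordinate of the eigenvector, which is therefore nonzero. *)
pose m0 : T := Sub (0%MM : 'X_{1..n}) (eq_ind_r (fun k => k < M)%N M0 mdeg0).
apply/eqP => /rowP/(_ (enum_rank m0)); rewrite !mxE enum_rankK mpolyX0 meval1.
by apply/eqP; rewrite oner_neq0.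
Qed.

End Reduction.

(** * Homogeneous ideals and substitutions *)

Section Homogeneous.
Variables (K : idomainType) (n : nat).
Implicit Types (p q : {mpoly K[n]}).

Lemma pihomogMr D q p e : p \is e.-homog ->
  pihomog mdeg D (q * p) = if (e <= D)%N then pihomog mdeg (D - e) q * p else 0.
Proof.
move=> pe; elim/mpolyind: q => [|c m q _ _ IHq].
  by rewrite mul0r !raddf0 mul0r if_same.
rewrite mulrDl !raddfD /= IHq -scalerAl !linearZ /= pihomogX.
have hom : 'X_[m] * p \is (mdeg m + e).-homog by apply: dhomogM; rewrite ?dhomogX.
case: (leqP e D) => eD; last first.
  rewrite addr0 (pihomog_ne0 _ hom) ?scaler0 //.
  by rewrite neq_ltn (leq_trans eD) ?leq_addl ?orbT.
rewrite mulrDl; congr (_ + _); case: eqP => [mD|/eqP mD].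
  by rewrite pihomog_dE -?scalerAl // (_ : D = mdeg m + e)%N // mD subnK.
rewrite (pihomog_ne0 _ hom) ?scaler0 ?mul0r //.
by apply: contraNneq mD => <-; rewrite addnK.
Qed.

Lemma msize_homog p d : p \is d.-homog -> (msize p <= d.+1)%N.
Proof.
move=> /dhomogP hp; rewrite msizeE; apply/bigmax_leqP_seq => m mp _.
by rewrite (hp m mp).
Qed.

Lemma pihomog_eq0 p : (forall D, pihomog mdeg D p = 0) -> p = 0.
Proof.
move=> p0; rewrite (pihomog_partitionE (mf := mdeg) (leqnn (msize p))).
by rewrite big1.
Qed.

Definition spanned (J : finType) (E : J -> {mpoly K[n]}) : set {mpoly K[n]} :=
  [set g | exists q : J -> {mpoly K[n]}, g = \sum_j q j * E j].

Lemma ideal_spanned (J : finType) (E : J -> {mpoly K[n]}) : ideal (spanned E).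
Proof.
split.
- by exists (fun=> 0); rewrite big1 // => j _; rewrite mul0r.
- move=> _ _ [q1 ->] [q2 ->]; exists (fun j => q1 j + q2 j).
  by rewrite -big_split; apply: eq_bigr => j _; rewrite mulrDl.
- move=> a _ [q ->]; exists (fun j => a * q j).
  by rewrite mulr_sumr; apply: eq_bigr => j _; rewrite mulrA.
Qed.

Lemma mem_spanned (J : finType) (E : J -> {mpoly K[n]}) j : spanned E (E j).
Proof.
exists (fun j' => (j == j')%:R); rewrite (bigD1 j) //= eqxx mul1r big1 ?addr0 //.
by move=> j' jj'; rewrite eq_sym (negbTE jj') mul0r.
Qed.

(** Each coefficient is replaced by its component of degree [D - e j], or by 0 when [e j] exceeds
    [D]. *)
Lemma pihomog_spanned (J : finType) (E : J -> {mpoly K[n]}) (e : J -> nat) D g :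
  (forall j, E j \is (e j).-homog) -> spanned E g ->
  exists2 q : J -> {mpoly K[n]}, pihomog mdeg D g = \sum_j q j * E j &
    forall j, (msize (q j) <= (D - e j).+1)%N.
Proof.
move=> Ee [q ->].
exists (fun j => if (e j <= D)%N then pihomog mdeg (D - e j) (q j) else 0) => [|j].
  rewrite raddf_sum; apply: eq_bigr => j _; rewrite /= (pihomogMr _ _ (Ee j)).
  by case: ifP; rewrite ?mul0r.
by case: ifP => _; rewrite ?msize0 // msize_homog // pihomogP.
Qed.

End Homogeneous.

Section Substitution.
Variables (K : closedFieldType) (n : nat).
Notation B := {mpoly K[n]}.

Definition subst c (y : 'I_c -> B) (F : {mpoly K[c]}) : B := F \mPo mktuple y.

HB.instance Definition _ c (y : 'I_c -> B) :=
  GRing.RMorphism.copy (subst y) (comp_mpoly (mktuple y)).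

Lemma substC c (y : 'I_c -> B) a : subst y a%:MP = a%:MP.
Proof. exact: comp_mpolyC. Qed.

Lemma substX c (y : 'I_c -> B) i : subst y 'X_i = y i.
Proof. by rewrite /subst comp_mpolyXU -tnth_nth tnth_mktuple. Qed.

Lemma meval_subst c (y : 'I_c -> B) F v :
  (subst y F).@[v] = F.@[fun i => (y i).@[v]].
Proof.
by rewrite /subst comp_mpoly_meval; apply: meval_eq => i; rewrite tnth_mktuple.
Qed.

Lemma substXm c (y : 'I_c -> B) m : subst y 'X_[m] = \prod_i y i ^+ m i.
Proof.
by rewrite /subst comp_mpolyX; apply: eq_bigr => i _; rewrite tnth_mktuple.
Qed.

Lemma pihomog_subst c (y : 'I_c -> B) F D : (forall i, y i \is 1.-homog) ->
  pihomog mdeg D (subst y F) = subst y (pihomog mdeg D F).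
Proof.
move=> y1; elim/mpolyind: F => [|a m F _ _ IHF]; first by rewrite !raddf0.
rewrite [subst y (_ + _)]rmorphD /= !pihomogD rmorphD /= IHF -!mul_mpolyC !rmorphM /= !substC
  !mul_mpolyC.
rewrite !linearZ /= pihomogX; congr (_ + _).
have hom : subst y 'X_[m] \is (mdeg m).-homog.
  rewrite substXm mdegE; elim/big_ind2: _ => [|p a1 q b1 hp hq|i _].
  - exact: dhomog1.
  - exact: dhomogM.
  - by rewrite -[X in X.-homog]mul1n; apply: dhomogMn.
case: eqP => [<-|/eqP mD]; first by rewrite pihomog_dE // -!mul_mpolyC rmorphM /= substC.
by rewrite (pihomog_ne0 _ hom) // !scaler0 rmorph0.
Qed.

Lemma subst_congr c (y y' : 'I_c -> B) J F : ideal J ->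
  (forall i, J (y i - y' i)) -> J (subst y F - subst y' F).
Proof.
move=> IJ yy'.
have JM a b a' b' : J (a - a') -> J (b - b') -> J (a * b - a' * b').
  move=> Ja Jb; have -> : a * b - a' * b' = b * (a - a') + a' * (b - b') by ring.
  by apply: (idealD IJ); apply: (idealMl IJ).
elim/mpolyind: F => [|a m F _ _ IHF]; first by rewrite !rmorph0 subrr; apply: ideal0.
rewrite !rmorphD /= -!mul_mpolyC !rmorphM /= !substC opprD addrACA.
apply: (idealD IJ) => //; apply: (JM); first by rewrite subrr; apply: ideal0.
rewrite !substXm; elim/big_ind2: _ => [|p a1 q b1|i _]; [|exact: JM|].
  by rewrite subrr; apply: ideal0.
elim: (m i) => [|k IHk]; first by rewrite !expr0 subrr; apply: ideal0.
by rewrite !exprS; apply: JM.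
Qed.

(** The Nullstellensatz for the zero ideal. *)
Lemma mpoly_nonroot m (F : {mpoly K[m]}) : F != 0 -> exists a, F.@[a] != 0.
Proof.
move=> /eqP F0; have P0 : prime_ideal [set f : {mpoly K[m]} | f = 0].
  split; [split=> //= | exact/eqP/oner_neq0 |].
  - by move=> x y -> ->; rewrite addr0.
  - by move=> a x ->; rewrite mulr0.
  - by move=> x y /= /eqP; rewrite mulf_eq0 => /orP[]/eqP; [left|right].
by have [a _] := nullstellensatz P0 F0; exists a.
Qed.

Lemma meval_homogZ m (F : {mpoly K[m]}) D a (t : K) : F \is D.-homog ->
  F.@[fun i => t * a i] = t ^+ D * F.@[a].
Proof.
move=> /dhomogP hF; rewrite !mevalE mulr_sumr; apply: eq_big_seq => k kF.
rewrite mulrCA; congr (_ * _); have /= <- := hF k kF; rewrite mdegE -prodrXr -big_split.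
by apply: eq_bigr => i _; rewrite exprMn.
Qed.

Lemma subst_homog_line c (F : {mpoly K[c]}) D a (w : B) : F \is D.-homog ->
  subst (fun i => a i *: w) F = F.@[a] *: w ^+ D.
Proof.
move=> /dhomogP hF; rewrite /subst comp_mpolyE mevalE scaler_suml; apply: eq_big_seq => k kF.
rewrite -scalerA; congr (_ *: _); have /= <- := hF k kF; rewrite mdegE -prodrXr -scaler_prod.
by apply: eq_bigr => i _; rewrite tnth_mktuple exprZn.
Qed.

End Substitution.

(** * Noether normalization and chains of primes *)

Section NoetherNormalization.
Variables (K : closedFieldType) (n : nat).
Notation B := {mpoly K[n]}.
Implicit Types (I J P : set B).

Definition independent_mod I c (y : 'I_c -> B) :=
  forall F : {mpoly K[c]}, I (subst y F) -> F = 0.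

(** Every variable is nilpotent modulo [I] and the [y j]. For homogeneous [I] and linear forms [y]
    this amounts to finiteness of the quotient by [I] over the polynomials in [y]. *)
Definition finite_over I c (y : 'I_c -> B) :=
  forall i, exists M, exists2 u, I u & exists q, 'X_i ^+ M = u + \sum_j q j * y j.

(** Take a homogeneous relation [F] of degree [D] and a point [t] with [F] and the last coordinate
    nonzero. Modulo [I] and the forms [y'], each [y j] equals [t j *: w], so the relation reads
    [F.@[t] *: w ^+ D = 0] and [w] is nilpotent. *)
Lemma finite_over_reduce I c (y : 'I_c.+1 -> B) F :
    ideal I -> (forall g D, I g -> I (pihomog mdeg D g)) ->
    (forall i, y i \is 1.-homog) -> finite_over I y -> I (subst y F) -> F != 0 ->
  exists2 y' : 'I_c -> B, (forall i, y' i \is 1.-homog) & finite_over I y'.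
Proof.
move=> II Ih y1 fin IF F0.
have [D FD0] : exists D, pihomog mdeg D F != 0.
  apply: contrapT => FD; case/eqP: F0; apply: pihomog_eq0 => D.
  by apply: contrapT => /eqP FD0; apply: FD; exists D.
have {IF} IF : I (subst y (pihomog mdeg D F)) by rewrite -pihomog_subst //; apply: Ih.
have hF := pihomogP mdeg D F.
move: (pihomog _ _ _) FD0 IF hF => {F0} {}F F0 IF hF.
have [t] : exists t, (F * 'X_ord_max).@[t] != 0.
  by apply: mpoly_nonroot; rewrite mulf_eq0 (negbTE F0) -(mmeasure_poly_eq0 mdeg) msizeX.
rewrite mevalM mevalXU mulf_eq0 negb_or => /andP[Ft tmax].
pose w : B := (t ord_max)^-1 *: y ord_max.
pose wi := widen_ord (leqnSn c).
pose y' i := y (wi i) - t (wi i) *: w.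
exists y' => [i|i].
  by rewrite rpredB // !rpredZ.
pose J := [set g : B | exists2 u, I u & exists q, g = u + \sum_j q j * y' j].
have IJ : ideal J.
  split.
  - by exists 0; [exact: ideal0|exists (fun=> 0); rewrite add0r big1 // => j _; rewrite mul0r].
  - move=> _ _ [u1 I1 [q1 ->]] [u2 I2 [q2 ->]]; exists (u1 + u2); first exact: idealD.
    exists (fun j => q1 j + q2 j); rewrite addrACA -big_split; congr (_ + _).
    by apply: eq_bigr => j _; rewrite mulrDl.
  - move=> a _ [u1 I1 [q1 ->]]; exists (a * u1); first exact: idealMl.
    exists (fun j => a * q1 j); rewrite mulrDr mulr_sumr; congr (_ + _).
    by apply: eq_bigr => j _; rewrite mulrA.
have IsJ : I `<=` J.
  by move=> u Iu; exists u => //; exists (fun=> 0); rewrite big1 ?addr0 // => j _; rewrite mul0r.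
have Jy j : J (y j - t j *: w).
  case: (unliftP ord_max j) => [k ->|->].
    have -> : lift ord_max k = wi k by apply: val_inj; rewrite /= /bump leqNgt ltn_ord.
    exists 0; first exact: ideal0.
    exists (fun k' => (k == k')%:R); rewrite (bigD1 k) //= eqxx mul1r big1 ?addr0 ?add0r //.
    by move=> j' jj'; rewrite eq_sym (negbTE jj') mul0r.
  by rewrite /w scalerA divff // scale1r subrr; apply: ideal0.
have JwD : J (w ^+ D).
  have : J (subst y F - subst (fun j => t j *: w) F) by apply: subst_congr.
  move/(idealN IJ); rewrite opprB => /(idealD IJ (IsJ _ IF)).
  rewrite addrC subrK (subst_homog_line _ _ hF) -mul_mpolyC.
  move/(idealMl IJ (F.@[t])^-1%:MP).
  by rewrite mulrA -mpolyCM mulVf // mul1r.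
(* Modulo [J] the power ['X_i ^+ M] is a multiple of [w], so its [D]-th power vanishes. *)
have [M [u Iu [q XM]]] := fin i; exists (M * D)%N.
pose b := \sum_j q j * (t j)%:MP.
have Jb : J ('X_i ^+ M - b * w).
  rewrite XM -addrA mulr_suml -sumrB; apply: (idealD IJ); first exact: IsJ.
  apply: (ideal_sum IJ) => j _.
  rewrite -mulrA -mulrBr mul_mpolyC; exact: (idealMl IJ).
have JX k : J ('X_i ^+ (M * k) - (b * w) ^+ k).
  elim: k => [|k IHk]; first by rewrite muln0 !expr0 subrr; apply: ideal0.
  rewrite mulnS exprD exprS.
  have -> : 'X_i ^+ M * 'X_i ^+ (M * k) - b * w * (b * w) ^+ k =
    'X_i ^+ (M * k) * ('X_i ^+ M - b * w) + b * w * ('X_i ^+ (M * k) - (b * w) ^+ k) :> B by ring.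
  by apply: (idealD IJ); apply: (idealMl IJ).
suff : J ('X_i ^+ (M * D)) by [].
rewrite -['X_i ^+ _](subrK ((b * w) ^+ D)); apply: (idealD IJ) => //.
by rewrite exprMn; apply: (idealMl IJ).
Qed.

(** Starting from the variables, one form is dropped as long as a relation exists. For [c = 0]
    independence would say that [I] is proper, which may fail. *)
Lemma noether_normalization I : ideal I -> (forall g D, I g -> I (pihomog mdeg D g)) ->
  exists c (y : 'I_c -> B), [/\ forall i, y i \is 1.-homog, finite_over I y &
    (0 < c)%N -> independent_mod I y].
Proof.
move=> II Ih.
have H c (y : 'I_c -> B) : (forall i, y i \is 1.-homog) -> finite_over I y ->
    exists c (y : 'I_c -> B), [/\ forall i, y i \is 1.-homog, finite_over I y &
    (0 < c)%N -> independent_mod I y].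
  elim: c y => [|c IHc] y y1 fin; first by exists 0%N, y.
  have [ind|] := pselect (independent_mod I y); first by exists c.+1, y.
  move/existsNP => [F] /not_implyP[IF /eqP F0].
  by have [y' y'1 fin'] := finite_over_reduce II Ih y1 fin IF F0; apply: IHc fin'.
apply: (H n (fun i => 'X_i)) => [i|i]; first by rewrite dhomogX /= mdeg1.
exists 1%N, 0; first exact: ideal0.
exists (fun j => (i == j)%:R); rewrite (bigD1 i) //= eqxx mul1r big1 ?addr0 ?add0r //.
by move=> j' jj'; rewrite eq_sym (negbTE jj') mul0r.
Qed.

Lemma finite_over_mdeg I c (y : 'I_c -> B) m0 : ideal I -> finite_over I y ->
  exists2 M, (m0 < M)%N & forall m, mdeg m = M ->
    exists2 u, I u & exists q, 'X_[m] = u + \sum_j q j * y j.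
Proof.
move=> II /choice[Mi MiP]; pose M0 := \max_i Mi i.
(* A degree above [n * M0] forces some exponent above [M0]; the summand [m0] gives [m0 < M]. *)
exists (n * M0 + m0).+1 => [|m mM]; first by rewrite ltnS leq_addl.
have [i mi] : exists i, (M0 < m i)%N.
  apply/existsP; rewrite -[X in is_true X]negbK negb_exists; apply/forallP => H.
  suff : (mdeg m <= n * M0)%N by rewrite mM; lia.
  rewrite mdegE -[X in (_ <= X * _)%N]card_ord -sum_nat_const; apply: leq_sum => i _.
  by rewrite leqNgt.
have [u Iu [q E]] := MiP i.
have le : (U_(i) *+ Mi i <= m)%MM.
  apply/mnm_lepP => j; rewrite mulmnE mnm1E; case: eqP => [<-|] //=.
  by rewrite mul1n; apply: leq_trans (ltnW mi); apply: leq_bigmax.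
exists ('X_[m - U_(i) *+ Mi i] * u); first exact: idealMl.
exists (fun j => 'X_[m - U_(i) *+ Mi i] * q j).
rewrite -{1}(submK le) mpolyXD -mpolyXn E mulrDr mulr_sumr; congr (_ + _).
by apply: eq_bigr => j _; rewrite mulrA.
Qed.

End NoetherNormalization.

(** * A chain of primes above the coordinate subspaces *)

Section PrimeChain.
Variables (K : closedFieldType) (n c : nat).
Notation B := {mpoly K[n]}.
Variables (I : set B) (y : 'I_c -> B) (M : nat).
Hypotheses (II : ideal I) (M0 : (0 < M)%N) (y_indep : independent_mod I y).
Hypothesis reduce : forall m, mdeg m = M -> exists2 u, I u &
  exists2 q, forall j, (msize (q j) <= M)%N & 'X_[m] = u + \sum_j q j * y j.

Definition kill_from j (F : {mpoly K[c]}) : {mpoly K[c]} :=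
  subst (fun i : 'I_c => if (i < j)%N then 'X_i else 0) F.

HB.instance Definition _ j :=
  GRing.RMorphism.copy (kill_from j) (@subst K c c (fun i :
    'I_c => if (i < j)%N then 'X_i else 0)).

Lemma kill_fromX j i : kill_from j 'X_i = if (i < j)%N then 'X_i else 0.
Proof. exact: substX. Qed.

Lemma kill_fromS j F : kill_from j (kill_from j.+1 F) = kill_from j F.
Proof.
apply: (@mpoly_rmorph_eq _ _ _ (kill_from j \o kill_from j.+1) (kill_from j)) => [a|i] /=.
  by rewrite /kill_from !substC.
rewrite !kill_fromX ltnS; case: (ltnP i j) => ij; first by rewrite (ltnW ij) kill_fromX ij.
by case: ifP => _; rewrite ?kill_fromX ?raddf0 // ltnNge ij.
Qed.

(* Geometrically: the projection by [y] maps the zero set of [P] dominantly to the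
   coordinate subspace where the coordinates of index at least [j] vanish. *)
Definition dominant j (P : set B) := forall F, P (subst y F) -> kill_from j F = 0.

(** Write F(y) = u + b y_j with [u] in [P]. Modulo [P], [b] is integral over the polynomials in [y];
    clearing denominators in its equation at F(y) / y_j gives a relation whose reduction at y_j = 0
    is a power of [F]. *)
Lemma dominant_adjoin (j : 'I_c) P : prime_ideal P -> I `<=` P -> dominant j.+1 P ->
  dominant j (adjoin P (y j)).
Proof.
move=> PP IP domP F [u Pu [b yF]].
pose Om := {a : 'I_n -> K | forall f, P f -> f.@[a] = 0}.
have [p pm pr] : exists2 p : {poly {mpoly K[c]}}, p \is monic &
    forall w : Om, root (map_poly (meval (fun l => (y l).@[sval w])) p) b.@[sval w].
  apply: (@reduction_integral K n c Om (fun w => sval w) _ M _ _ M0) => m mM.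
  have [v Iv [q qM E]] := reduce mM; exists q => // w.
  rewrite E mevalD (svalP w _ (IP _ Iv)) add0r rmorph_sum; apply: eq_bigr => l _.
  by rewrite rmorphM mulrC.
pose t := (size p).-1.
have tE : size p = t.+1 by rewrite prednK // size_poly_gt0 monic_neq0.
(* The homogenization of [p] at [F] and ['X_j]: at zeros of [P] it takes the value y_j^t p(b) = 0,
   and killing ['X_j] leaves only the term [F ^+ t]. *)
pose Phi := \sum_(i < t.+1) p`_i * F ^+ i * 'X_j ^+ (t - i).
have kPhi : kill_from j.+1 Phi = 0.
  apply: domP; apply: contrapT => /(nullstellensatz PP)[a Pa]; case/negP; apply/eqP.
  have /rootP := pr (exist _ a Pa); rewrite horner_poly tE => pa.
  have yFa : F.@[fun i => (y i).@[a]] = b.@[a] * (y j).@[a].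
    by rewrite -meval_subst yF mevalD mevalM Pa // add0r.
  rewrite meval_subst rmorph_sum /=.
  rewrite (eq_bigr (fun i : 'I_t.+1 => (y j).@[a] ^+ t *
     ((p`_i).@[fun i => (y i).@[a]] * b.@[a] ^+ i))).
    by rewrite -mulr_sumr pa mulr0.
  move=> i _; rewrite !rmorphM !rmorphXn /= mevalXU yFa exprMn.
  have -> : (y j).@[a] ^+ t = (y j).@[a] ^+ i * (y j).@[a] ^+ (t - i).
    by rewrite -exprD subnKC // -ltnS.
  by ring.
have : kill_from j Phi = 0 by rewrite -kill_fromS kPhi rmorph0.
rewrite rmorph_sum big_ord_recr big1 /= => [|i _].
  have -> : p`_t = 1 by exact: (monicP pm).
  rewrite add0r subnn expr0 mulr1 mul1r rmorphXn => /eqP.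
  by rewrite expf_eq0 => /andP[_ /eqP].
rewrite rmorphM rmorphXn /= kill_fromX ltnn expr0n subn_eq0 leqNgt ltn_ord.
by rewrite mulr0.
Qed.

(** The elements [subst y F] with [kill_from j F != 0] form a multiplicative set, since
    [kill_from j] is a morphism into a domain; a prime avoiding it is dominant. *)
Lemma dominant_prime j J : ideal J -> dominant j J ->
  exists P, [/\ prime_ideal P, J `<=` P & dominant j P].
Proof.
move=> IJ domJ.
pose S := [set g : B | exists2 F, kill_from j F != 0 & g = subst y F].
have [|||P [PP JP PS]] := @exists_prime_ideal _ J S IJ.
- by exists 1; rewrite ?rmorph1 ?oner_neq0.
- move=> _ _ [F F0 ->] [G G0 ->]; exists (F * G); last by rewrite rmorphM.
  by rewrite rmorphM mulf_neq0.
- by move=> x Jx [F /eqP F0 xE]; apply/F0/domJ; rewrite -xE.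
exists P; split=> // F /PS nS; apply: contrapT => /eqP F0; apply: nS.
by exists F.
Qed.

(** Built downwards from [j = c]: the first prime comes from the independence of [y], each next one
    from adjoining [y j]. *)
Lemma exists_prime_chain : exists P : nat -> set B,
  (forall j, (j <= c)%N -> [/\ prime_ideal (P j), I `<=` P j & dominant j (P j)]) /\
  (forall j : 'I_c, P j.+1 `<=` P j /\ P j (y j)).
Proof.
suff H k : (k <= c)%N -> exists P : nat -> set B,
  (forall j, (c - k <= j <= c)%N -> [/\ prime_ideal (P j), I `<=` P j & dominant j (P j)]) /\
  (forall j : 'I_c, (c - k <= j)%N -> P j.+1 `<=` P j /\ P j (y j)).
  have [P [P1 P2]] := H c (leqnn _); rewrite subnn in P1 P2.
  by exists P; split=> [j jc|j]; [apply: P1 | apply: P2].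
elim: k => [|k IHk] kc.
  have [|P [PP IP dP]] := @dominant_prime c I II.
    by move=> F /y_indep ->; rewrite rmorph0.
  exists (fun=> P); rewrite subn0; split=> j; first by rewrite -eqn_leq => /eqP <-.
  by rewrite leqNgt ltn_ord.
have [P [P1 P2]] := IHk (ltnW kc).
have jc : (c - k.+1 < c)%N by rewrite ltn_subrL (leq_ltn_trans _ kc).
pose j := Ordinal jc.
have jS : j.+1 = (c - k)%N by rewrite /= subnSK.
have [PP IP dP] : [/\ prime_ideal (P j.+1), I `<=` P j.+1 & dominant j.+1 (P j.+1)].
  by apply: P1; rewrite -jS leqnn.
have [Q [QQ PQ dQ]] :=
  dominant_prime (ideal_adjoin (y j) (prime_idealW PP)) (dominant_adjoin PP IP dP).
exists (fun i => if i == j :> nat then Q else P i); split=> i.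
  case/andP=> ji ic; case: eqP => [->|/eqP ij].
    by split=> // g /IP/(@sub_adjoin _ _ (y j))/PQ.
  by apply: P1; rewrite ic andbT -jS ltn_neqAle eq_sym ij.
move=> ji; case: (eqVneq (i : nat) j) => [ij|ij].
  rewrite ij gtn_eqF // (_ : i = j); last exact: val_inj.
  by split=> [g /(@sub_adjoin _ _ (y j))/PQ //|]; apply/PQ/mem_adjoin/prime_idealW.
have ji' : (j < i)%N by rewrite ltn_neqAle eq_sym ij.
by rewrite gtn_eqF ?leqW //; apply: P2; rewrite -jS.
Qed.

End PrimeChain.

(** * Tangent spaces and projective points *)

Lemma submm n (m : 'X_{1..n}) : (m - m = 0)%MM.
Proof. by rewrite -{1}[m]add0m addmK. Qed.

Section DerivativesHomogeneous.
Variables (K : idomainType) (n : nat).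
Implicit Types (g : {mpoly K[n]}).

Lemma mderiv_homog g d i : g \is d.-homog -> g^`M(i) \is d.-1.-homog.
Proof.
move=> /dhomogP hg; apply/dhomogP => m; rewrite mcoeff_msupp mcoeff_mderiv => gm.
have /hg : (m + U_(i))%MM \in msupp g.
  by rewrite mcoeff_msupp; apply: contraNneq gm => ->; rewrite mul0rn.
by rewrite /= mdegD mdeg1 addn1 => <-.
Qed.

Lemma msize_mderiv g i : (msize g^`M(i) <= (msize g).-1)%N.
Proof.
rewrite msizeE; apply/bigmax_leqP_seq => m + _.
rewrite mcoeff_msupp mcoeff_mderiv => gm.
have /msize_mdeg_lt : (m + U_(i))%MM \in msupp g.
  by rewrite mcoeff_msupp; apply: contraNneq gm => ->; rewrite mul0rn.
by rewrite mdegD mdeg1 addn1; case: (msize g).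
Qed.

Lemma euler_homog g d : g \is d.-homog -> \sum_i 'X_i * g^`M(i) = d%:R *: g.
Proof.
move=> /dhomogP hg; rewrite [RHS](congr1 _ (mpolyE g)) scaler_sumr.
rewrite (eq_bigr (fun i => \sum_(m <- msupp g) g@_m *: ('X_i * ('X_[m])^`M(i)))).
  rewrite exchange_big; apply: eq_big_seq => m mg; rewrite -scaler_sumr scalerA mulrC -scalerA.
  congr (_ *: _); have /= <- := hg m mg; rewrite mdegE natr_sum scaler_suml.
  apply: eq_bigr => i _; rewrite mderivX -scalerAr.
  have [->|mi] := posnP (m i); first by rewrite !scale0r.
  by rewrite -mpolyXD addmC submK // lep1mP -lt0n.
move=> i _; rewrite {1}[g]mpolyE raddf_sum mulr_sumr; apply: eq_bigr => m _.
by rewrite /= mderivZ -scalerAr.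
Qed.

Lemma mpoly_ring_ind (P : {mpoly K[n]} -> Prop) :
  (forall c, P c%:MP) -> (forall i, P 'X_i) ->
  (forall f g, P f -> P g -> P (f + g)) -> (forall f g, P f -> P g -> P (f * g)) ->
  forall f, P f.
Proof.
move=> PC PX PD PM; elim/mpolyind => [|c m p _ _ Pp]; first by rewrite -mpolyC0.
apply: PD => //; rewrite -mul_mpolyC; apply: (PM) => //; rewrite mpolyXE_id.
elim/big_ind: _ => [||i _]; [by rewrite -mpolyC1|exact: (PM)|].
by elim: (m i) => [|k IHk]; rewrite ?expr0 -?mpolyC1 // exprS; apply: PM.
Qed.

Lemma mevalX0 m : ('X_[m] : {mpoly K[n]}).@[fun=> 0] = (m == 0%MM)%:R.
Proof.
have [->|] := eqVneq m 0%MM; first by rewrite mpolyX0 meval1.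
rewrite -mdeg_eq0 mdegE sum_nat_eq0 negb_forall => /existsP[i]; rewrite implyTb => mi.
by rewrite mevalX (bigD1 i) //= expr0n (negbTE mi) mul0r.
Qed.

Lemma meval_pihomog1 g v :
  (pihomog mdeg 1 g).@[v] = \sum_k (g^`M(k)).@[fun=> 0] * v k.
Proof.
elim/mpolyind: g => [|c m g _ _ IHg].
  by rewrite raddf0 meval0 big1 // => k _; rewrite mderiv0 meval0 mul0r.
rewrite pihomogD mevalD IHg.
under [RHS]eq_bigr => k _ do rewrite mderivD mevalD mulrDl.
rewrite big_split /=; congr (_ + _); rewrite linearZ /= mevalZ pihomogX.
rewrite (eq_bigr (fun k => c * ((m k)%:R * ((m - U_(k))%MM == 0%MM)%:R * v k))); last first.
  by move=> k _; rewrite mderivZ mevalZ mderivX mevalZ mevalX0 -!mulrA.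
rewrite -mulr_sumr; congr (_ * _).
case: (boolP (mdeg m == 1%N)) => [/mdeg1P[i /eqP ->]|m1].
  rewrite mevalXU (bigD1 i) //= mnm1E eqxx submm eqxx !mul1r big1 ?addr0 // => k ki.
  by rewrite mnm1E eq_sym (negbTE ki) !mul0r.
rewrite meval0 big1 // => k _; have [->|mk] := posnP (m k); first by rewrite !mul0r.
case: eqP => [/(congr1 (fun a => a + U_(k))%MM)|]; last by rewrite mulr0 mul0r.
rewrite submK ?lep1mP -?lt0n // add0m => mE.
by move: m1; rewrite mE mdeg1.
Qed.

End DerivativesHomogeneous.

Section TangentSpace.
Variables (K : fieldType) (n : nat).
Notation B := {mpoly K[n.+1]}.
Implicit Types (p : proj_space K n) (g h : B).

(** The representative of [p] whose coordinate of index [j] is 1, when [hcoord p j] is nonzero. *)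
Definition normalized j p : 'I_n.+1 -> K := fun i => hcoord p i / hcoord p j.

(** Chain rule for [phi], which dehomogenizes and moves [p] to the origin; both sides obey the
    Leibniz rule, so it suffices to compare them on constants and variables. *)
Lemma linear_partE j p g v : hcoord p j != 0 ->
  (linear_part j p g).@[v] = \sum_k (g^`M(lift j k)).@[normalized j p] * v k.
Proof.
move=> pj; rewrite /linear_part meval_pihomog1; apply: eq_bigr => k _; congr (_ * _).
pose phi : {rmorphism B -> {mpoly K[n]}} :=
  comp_mpoly [tuple 'X_k + (affcoord j p k)%:MP | k < n] \o
  comp_mpoly [tuple (if unlift j i is Some k then 'X_k else 1) | i < n.+1].
rewrite -[X in X^`M(k)]/(phi g).
have phiC c : phi c%:MP = c%:MP by rewrite /phi /= !comp_mpolyC.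
have phiX i : phi 'X_i = if unlift j i is Some k then 'X_k + (affcoord j p k)%:MP else 1.
  rewrite /phi /= comp_mpolyXU -tnth_nth tnth_mktuple; case: (unlift j i) => [l|].
    by rewrite comp_mpolyXU -tnth_nth tnth_mktuple.
  by rewrite rmorph1.
have eps f : (phi f).@[fun=> 0] = f.@[normalized j p].
  apply: (@mpoly_rmorph_eq _ _ _ (meval (fun=> 0) \o phi) (meval (normalized j p))) => [c|i].
    by rewrite -[LHS]/((phi c%:MP).@[_]) phiC [RHS]mevalC mevalC.
  rewrite -[LHS]/((phi 'X_i).@[_]) -[RHS]/(('X_i : B).@[_]) phiX mevalXU /normalized;
    case: unliftP => [l ->|->].
    by rewrite mevalD mevalXU mevalC add0r.
  by rewrite meval1 divff.
elim/mpoly_ring_ind: g => [c|i|f g IHf IHg|f g IHf IHg].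
- by rewrite phiC !mderivC !meval0.
- rewrite phiX mderivX !mevalZ mnm1E; case: unliftP => [l ->|->].
    rewrite mderivD mderivC addr0 mderivX !mevalZ mnm1E (inj_eq lift_inj).
    case: eqP => [->|]; last by rewrite !mul0r.
    by rewrite !submm !mpolyX0 !meval1.
  by rewrite -mpolyC1 mderivC meval0 (negbTE (neq_lift _ _)) mul0r.
- by rewrite rmorphD !mderivD !mevalD IHf IHg.
- by rewrite rmorphM !mderivM !mevalD !mevalM IHf IHg !eps.
Qed.

(** The columns of [cokermx A] are killed by [A], hence by [H], which is the criterion for [H] to
    lie in the row space. *)
Lemma linear_form_combination r (H : 'rV[K]_n) (A : 'M[K]_(r, n)) :
  (forall v : 'I_n -> K, (forall i, \sum_k A i k * v k = 0) -> \sum_k H 0 k * v k = 0) ->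
  exists a : 'rV_r, H = a *m A.
Proof.
move=> HA; apply/submxP; rewrite submxE; apply/eqP/rowP => l; rewrite !mxE.
apply: (HA (fun k => cokermx A k l)) => i.
by have /matrixP/(_ i l) := mulmx_coker A; rewrite !mxE.
Qed.

(** The chart sees only the derivatives other than the one of index [j]; at a zero of [g] Euler's
    identity recovers that one. *)
Lemma euler_normalized j p g d : hcoord p j != 0 -> g \is d.-homog ->
  g.@[normalized j p] = 0 ->
  (g^`M(j)).@[normalized j p] =
    - \sum_k normalized j p (lift j k) * (g^`M(lift j k)).@[normalized j p].
Proof.
move=> pj /euler_homog/(congr1 (meval (normalized j p))) E g0.
move: E; rewrite mevalZ g0 mulr0 rmorph_sum (bigD1_ord j) //= mevalM mevalXU.
rewrite /normalized divff // mul1r => /eqP; rewrite addr_eq0 => /eqP ->.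
by congr (- _); apply: eq_bigr => k _; rewrite mevalM mevalXU.
Qed.

Lemma normalizedE j p : hcoord p j != 0 ->
  hcoord p =1 fun i => hcoord p j * normalized j p i.
Proof. by move=> pj i; rewrite /normalized mulrC divfK. Qed.

End TangentSpace.

(** * Lagrange multipliers on the cone over the tangency locus *)

Section Tangency.
Variables (K : closedFieldType) (n r d : nat).
Notation B := {mpoly K[n.+1]}.
Variables (hs : 'I_r -> B) (h : B) (e : 'I_r -> nat).
Hypotheses (e_lt : forall i, (e i < d)%N) (hs_homog : forall i, hs i \is (e i).-homog).
Hypothesis h_homog : h \is d.-homog.

Lemma homog_meval_hcoord j (p : proj_space K n) g k : hcoord p j != 0 -> g \is k.-homog ->
  g.@[hcoord p] = 0 -> g.@[normalized j p] = 0.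
Proof.
move=> pj gk; rewrite (meval_eq _ (normalizedE pj)) (meval_homogZ _ _ gk) => /eqP.
by rewrite mulf_eq0 expf_eq0 (negbTE pj) andbF => /eqP.
Qed.

(** Linear algebra gives multipliers at the normalized point, and Euler's identity extends them to
    all derivatives. At [u] times that point the multiplier of [hs i] is scaled by [u ^+ (d - e i)]
    to match degrees, which also covers [t = 0]. *)
Lemma tangency_multipliers p t : tangency_locus h (range hs) p ->
  exists a : 'I_r -> K,
    h.@[fun i => t * hcoord p i] = \sum_i a i * (hs i).@[fun i => t * hcoord p i] /\
    forall k, (h^`M(k)).@[fun i => t * hcoord p i] =
      \sum_i a i * ((hs i)^`M(k)).@[fun i => t * hcoord p i].
Proof.
move=> [hp hsp [j pj tan]]; set q := normalized j p.
have hq : h.@[q] = 0 by apply: homog_meval_hcoord h_homog _ => //; apply: hp.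
have hsq i : (hs i).@[q] = 0.
  by apply: homog_meval_hcoord (hs_homog i) _ => //; apply: hsp; exists i.
have [D DE] : exists D : 'rV_r, \row_k (h^`M(lift j k)).@[q] =
    D *m \matrix_(i, k) ((hs i)^`M(lift j k)).@[q].
  apply: linear_form_combination => v Hv.
  have Tv : tangent_space j p (range hs) v.
    move=> _ [i _ <-]; rewrite linear_partE // -[RHS](Hv i).
    by apply: eq_bigr => k _; rewrite mxE.
  rewrite -[RHS](tan v Tv h erefl) linear_partE //.
  by apply: eq_bigr => k _; rewrite mxE.
have gradl k : (h^`M(lift j k)).@[q] = \sum_i D 0 i * ((hs i)^`M(lift j k)).@[q].
  move/rowP/(_ k): DE; rewrite !mxE => ->.
  by apply: eq_bigr => i _; rewrite mxE.
have gradq k : (h^`M(k)).@[q] = \sum_i D 0 i * ((hs i)^`M(k)).@[q].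
  case: (unliftP j k) => [l ->|->]; first exact: gradl.
  rewrite (euler_normalized pj h_homog hq).
  under [RHS]eq_bigr => i _ do rewrite (euler_normalized pj (hs_homog i) (hsq i)) mulrN mulr_sumr.
  rewrite sumrN exchange_big; congr (- _); apply: eq_bigr => l _ /=.
  by rewrite gradl mulr_sumr; apply: eq_bigr => i _; rewrite mulrCA.
pose u := t * hcoord p j.
have tq : (fun i => t * hcoord p i) =1 (fun i => u * q i).
  by move=> i; rewrite (normalizedE pj) mulrA.
exists (fun i => u ^+ (d - e i) * D 0 i); split=> [|k].
  rewrite (meval_eq _ tq) (meval_homogZ _ _ h_homog) hq mulr0 big1 // => i _.
  by rewrite (meval_eq _ tq) (meval_homogZ _ _ (hs_homog i)) hsq !mulr0.
rewrite (meval_eq _ tq) (meval_homogZ _ _ (mderiv_homog k h_homog)) gradq mulr_sumr.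
apply: eq_bigr => i _.
rewrite (meval_eq _ tq) (meval_homogZ _ _ (mderiv_homog k (hs_homog i))).
(* For [e i = 0] the truncated [(e i).-1] breaks the count of exponents, but then [hs i] is constant
   and its derivatives vanish. *)
have [e0|e0] := posnP (e i); last first.
  have -> : d.-1 = (d - e i + (e i).-1)%N by have := e_lt i; lia.
  by rewrite exprD; ring.
have : msize (hs i)^`M(k) == 0%N.
  rewrite -leqn0 (leq_trans (msize_mderiv _ _)) //.
  by have := msize_homog (hs_homog i); rewrite e0; case: (msize _) => [|[]].
by rewrite mmeasure_poly_eq0 => /eqP ->; rewrite meval0 !mulr0.
Qed.

End Tangency.

(** * Projective zero loci of primes *)

Section ProjectivePoints.
Variables (K : closedFieldType) (n : nat).
Notation B := {mpoly K[n.+1]}.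
Notation proj := (proj_space K n).

Lemma hcoord_neq0 (p : proj) : exists i, hcoord p i != 0.
Proof.
have := valP (repr p); rewrite -/(hcoord p) => /rV0Pn[i pi].
by exists i.
Qed.

Lemma exists_proj_point (a : 'I_n.+1 -> K) : (exists i, a i != 0) ->
  exists p : proj, exists2 t, t != 0 & hcoord p =1 fun i => t * a i.
Proof.
move=> [i ai].
have w0 : \row_i a i != 0 by apply/rV0Pn; exists i; rewrite mxE.
pose x : nzvec K n := exist (fun v : 'rV[K]_n.+1 => v != 0) _ w0.
exists (\pi_(proj)%qT x).
have : (repr (\pi_(proj)%qT x) == x %[mod proj])%qT by rewrite reprK.
rewrite eqmodE => /proportionalP[t t0 E]; exists t => // k.
by rewrite /hcoord E !mxE.
Qed.

(** [P] need not be homogeneous: this is the zero locus of the ideal generated by its homogeneous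
    elements. *)
Definition prime_zlocus (P : set B) : set proj :=
  zlocus [set g | (exists d : nat, g \is d.-homog) /\ P g].

Lemma zclosed_prime_zlocus P : zclosed (prime_zlocus P).
Proof. by exists [set g | (exists d : nat, g \is d.-homog) /\ P g] => // g []. Qed.

Variables (P : set B) (l : B).
Hypotheses (PP : prime_ideal P) (l1 : l \is 1.-homog) (Pl : ~ P l).

(** The factor [l] in [g * l] keeps the zero given by the Nullstellensatz away from the origin, so
    that it defines a projective point. *)
Lemma prime_zlocus_nonroot g d : g \is d.-homog -> ~ P g ->
  exists2 p, prime_zlocus P p & g.@[hcoord p] != 0.
Proof.
move=> gd Pg; have : ~ P (g * l) by move/(prime_idealM PP) => [].
move=> /(nullstellensatz PP)[a Pa]; rewrite mevalM mulf_eq0 negb_or => /andP[ga la].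
have [|p [t t0 pE]] := @exists_proj_point a.
  apply: contrapT => a0; case/eqP: la.
  have -> : l.@[a] = l.@[fun i => 0 * a i].
    apply: meval_eq => i; rewrite mul0r; apply: contrapT => /eqP ai.
    by apply: a0; exists i.
  by rewrite (meval_homogZ _ _ l1) expr1 mul0r.
exists p => [f [[e fe] Pf]|]; rewrite (meval_eq _ pE).
  by rewrite (meval_homogZ _ _ fe) Pa ?mulr0.
by rewrite (meval_homogZ _ _ gd) mulf_neq0 // expf_neq0.
Qed.

Lemma prime_zlocus_irreducible : zirreducible (prime_zlocus P).
Proof.
split.
  have [p Pp _] := prime_zlocus_nonroot (dhomog1 _ _) (prime_ideal1 PP).
  by exists p.
move=> F G [S Sh ->] [S' Sh' ->] FG.
apply: contrapT => /not_orP[nF nG].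
have H S0 : (forall g, S0 g -> exists d : nat, g \is d.-homog) ->
    ~ prime_zlocus P `<=` zlocus S0 -> exists g, S0 g /\ ~ P g.
  move=> S0h nS; apply: contrapT => H; apply: nS => p Pp g S0g.
  apply: Pp; split; first exact: S0h.
  by apply: contrapT => Pg; apply: H; exists g.
have [f [Sf Pf]] := H _ Sh nF; have [g [Sg Pg]] := H _ Sh' nG.
have [df hf] := Sh _ Sf; have [dg hg] := Sh' _ Sg.
have Pfg : ~ P (f * g) by move/(prime_idealM PP) => [].
have [p Pp] := prime_zlocus_nonroot (dhomogM hf hg) Pfg.
rewrite mevalM mulf_eq0 negb_or => /andP[fp gp].
by case: (FG _ Pp) => [/(_ _ Sf)/eqP|/(_ _ Sg)/eqP]; apply/negP.
Qed.

End ProjectivePoints.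

(** * Dimensions of the two loci *)

Section FiniteSpanned.
Variables (K : closedFieldType) (n c : nat) (J : finType).
Notation B := {mpoly K[n]}.
Variables (E : J -> B) (e : J -> nat) (y : 'I_c -> B).
Hypotheses (E_homog : forall j, E j \is (e j).-homog) (y1 : forall i, y i \is 1.-homog).

(** The degree bounds come from taking components of degree [M], with the [y l] counted as further
    generators, of degree 1. *)
Lemma finite_over_spanned m0 : finite_over (spanned E) y ->
  exists2 M, (m0 < M)%N & forall m, mdeg m = M ->
    exists (q : J -> B) (q' : 'I_c -> B),
      [/\ 'X_[m] = \sum_j q j * E j + \sum_l q' l * y l,
          forall j, (msize (q j) <= (M - e j).+1)%N & forall l, (msize (q' l) <= M)%N].
Proof.
move=> /(finite_over_mdeg m0 (ideal_spanned E))[M m0M HM]; exists M => // m mM.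
have [_ [q ->] [q' XE]] := HM m mM.
pose E2 (jl : J + 'I_c) := match jl with inl j => E j | inr l => y l end.
pose e2 (jl : J + 'I_c) := match jl with inl j => e j | inr l => 1%N end.
have [||q2 q2E q2M] := @pihomog_spanned _ _ _ E2 e2 M 'X_[m].
- by case.
- exists (fun jl => match jl with inl j => q j | inr l => q' l end).
  by rewrite big_sumType.
exists (q2 \o inl), (q2 \o inr); split=> [|j|l].
- by rewrite big_sumType /= in q2E; rewrite -q2E pihomog_dE // dhomogX /= mM.
- exact: q2M (inl j).
- by apply: leq_trans (q2M (inr l)) _; rewrite /= subn1 prednK // (leq_ltn_trans _ m0M).
Qed.

End FiniteSpanned.

Section SingularLocus.
Variables (K : closedFieldType) (n d : nat).
Notation B := {mpoly K[n.+1]}.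
Variable h : B.
Hypothesis h_homog : h \is d.-homog.

Definition jacobian (g : B) (j : option 'I_n.+1) : B := if j is Some k then g^`M(k) else g.
Definition jacobian_deg (j : option 'I_n.+1) := if j is Some _ then d.-1 else d.

Lemma jacobian_homog j : jacobian h j \is (jacobian_deg j).-homog.
Proof. by case: j => [k|] //=; apply: mderiv_homog. Qed.

(** The primes [P 1], ..., [P c] cut out a strictly increasing chain of [c] irreducible sets in the
    singular locus, so [c.-1 <= s]. [P 0] is left out: it contains all [y] and has no projective
    zero. *)
Lemma singular_locus_parameters (s : int) : dim_le (singular_locus h) s ->
  exists c (y : 'I_c -> B), [/\ c%:Z <= s + 1, forall i, y i \is 1.-homog &
    finite_over (spanned (jacobian h)) y].
Proof.
move=> [s1 dims]; set I := spanned _; have II : ideal I := ideal_spanned _.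
have Ih g D : I g -> I (pihomog mdeg D g).
  move=> Ig; have [q E _] := pihomog_spanned D jacobian_homog Ig.
  by exists q.
have [c [y [y1 fin ind]]] := noether_normalization II Ih.
exists c, y; split=> //; have [->|c0] := posnP c; first by lia.
have [M M0 HM] := finite_over_spanned jacobian_homog y1 0 fin.
have [|P [P1 P2]] := exists_prime_chain II M0 (ind c0).
  move=> m /HM [q [q' [XE _ q'M]]]; exists (\sum_j q j * jacobian h j); first by exists q.
  by exists q'.
(* This linear form lies outside all the primes used and serves as the [l] of
   [prime_zlocus_nonroot]. *)
pose y0 := y (Ordinal c0).
have Py0 j : (0 < j <= c)%N -> ~ P j y0.
  case/andP=> j0 jc; have [_ _ dP] := P1 j jc.
  rewrite /y0 -substX => /dP; rewrite kill_fromX j0 => /eqP.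
  by rewrite -(mmeasure_poly_eq0 mdeg) msizeX.
suff : (c.-1)%:Z <= s by lia.
apply: (dims _ (fun i => prime_zlocus (P i.+1))); split=> i ic.
  have ic1 : (0 < i.+1 <= c)%N by lia.
  have [PP IP _] := P1 _ (proj2 (andP ic1)).
  split; first exact: prime_zlocus_irreducible PP (y1 _) (Py0 _ ic1).
  exists (prime_zlocus (P i.+1)); first exact: zclosed_prime_zlocus.
  apply/seteqP; split=> [p Pp|p [] //]; split=> //.
  have Pj j : (jacobian h j).@[hcoord p] = 0.
    apply: Pp; split; first by exists (jacobian_deg j); exact: jacobian_homog.
    by apply/IP/mem_spanned.
  by split=> [g ->|k]; [exact: (Pj None) | exact: (Pj (Some k))].
have ic1 : (i.+1 < c)%N by lia.
have [Psub Py] := P2 (Ordinal ic1); rewrite /= in Psub Py.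
split=> [p Pp g [gh Pg]|sub].
  by apply: Pp; split=> //; apply: Psub.
have [PP _ dP] := P1 i.+2 ic1.
have nP : ~ P i.+2 (y (Ordinal ic1)).
  rewrite -substX => /dP; rewrite kill_fromX /= ltnSn => /eqP.
  by rewrite -(mmeasure_poly_eq0 mdeg) msizeX.
have [|p Pp] := prime_zlocus_nonroot PP (y1 (Ordinal c0)) _ (y1 (Ordinal ic1)) nP.
  by apply: Py0.
by case/eqP; apply: (sub _ Pp); split=> //; exists 1%N.
Qed.

End SingularLocus.

(** The ideal of the affine cone over [Z], vertex included through [t = 0]. *)
Definition cone_ideal (K : fieldType) n (Z : set (proj_space K n)) : set {mpoly K[n.+1]} :=
  [set g | forall p t, Z p -> g.@[fun i => t * hcoord p i] = 0].

Section ConeIdeal.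
Variables (K : closedFieldType) (n : nat).
Notation B := {mpoly K[n.+1]}.
Implicit Types (Z : set (proj_space K n)) (g : B).

Lemma closed_field_poly_eq0 (q : {poly K}) : (forall t, q.[t] = 0) -> q = 0.
Proof.
move=> q0; apply: contrapT => /eqP /closed_nonrootP[t /negP]; apply.
exact/eqP.
Qed.

Lemma meval_line g (a : 'I_n.+1 -> K) t : g.@[fun i => t * a i] =
  (\poly_(k < msize g) (pihomog mdeg k g).@[a]).[t].
Proof.
rewrite horner_poly {1}[g](pihomog_partitionE (mf := mdeg) (leqnn _)) rmorph_sum.
by apply: eq_bigr => k _; rewrite /= (meval_homogZ _ _ (pihomogP _ _ _)) mulrC.
Qed.

(** A polynomial vanishes on the line through a point exactly when all its homogeneous components
    vanish at that point, [K] being infinite. *)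
Lemma zclosed_cone g : zclosed [set p :
  proj_space K n | forall t, g.@[fun i => t * hcoord p i] = 0].
Proof.
exists [set f | exists k, f = pihomog mdeg k g]; first by move=> _ [k ->]; exists k;
  apply: pihomogP.
apply/seteqP; split=> p.
  move=> gp _ [k ->].
  have /polyP/(_ k) : \poly_(k < msize g) (pihomog mdeg k g).@[hcoord p] = 0.
    by apply: closed_field_poly_eq0 => t; rewrite -meval_line.
  rewrite coef_poly coef0; case: ltnP => // gk _.
  rewrite pihomogE big_seq_cond big_pred0 ?meval0 // => m.
  apply/negP => /andP[/msize_mdeg_lt + /eqP /= mk]; rewrite mk ltnNge gk //.
move=> gp t; rewrite meval_line horner_poly big1 // => k _.
by rewrite gp ?mul0r //; exists k.
Qed.

(** On each line of the cone one factor vanishes identically, a product of univariate polynomials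
    being zero; irreducibility of [Z] selects the same factor for all lines. *)
Lemma cone_ideal_prime Z : zirreducible Z -> prime_ideal (cone_ideal Z).
Proof.
move=> [[p0 Zp0] irr]; split; first split.
- by move=> p t _; rewrite meval0.
- by move=> f g If Ig p t Zp; rewrite mevalD If // Ig // addr0.
- by move=> f g Ig p t Zp; rewrite mevalM Ig // mulr0.
- by move/(_ p0 0 Zp0)/eqP; rewrite meval1 oner_eq0.
move=> f g fg; have := irr _ _ (zclosed_cone f) (zclosed_cone g).
case=> [p Zp|Zf|Zg]; last 2 first.
- by left=> p t Zp; apply: Zf.
- by right=> p t Zp; apply: Zg.
pose L (u : B) := \poly_(k < msize u) (pihomog mdeg k u).@[hcoord p].
have : L f * L g = 0.
  apply: closed_field_poly_eq0 => t.
  by rewrite hornerM -!meval_line -mevalM; apply: fg.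
have LE u : L u = 0 -> forall t, u.@[fun i => t * hcoord p i] = 0.
  by move=> L0 t; rewrite meval_line -/(L u) L0 horner0.
by move/eqP; rewrite mulf_eq0 => /orP[]/eqP /LE; [left|right].
Qed.

(* The chain is extended by the ideal of the origin, whence [k.+1] elements. *)
Lemma irr_chain_independent T k (Z : nat -> set (proj_space K n)) : irr_chain T k Z ->
  exists f : 'I_k.+1 -> B, forall F, cone_ideal (Z k) (subst f F) -> F = 0.
Proof.
move=> [Zirr Zlt].
pose P i : set B := if i is j.+1 then cone_ideal (Z j) else [set g | g.@[fun=> 0] = 0].
have P0 : prime_ideal (P 0%N).
  split; [split | |] => /=.
  - exact: meval0.
  - by move=> x y /= x0 y0; rewrite mevalD x0 y0 addr0.
  - by move=> a x /= x0; rewrite mevalM x0 mulr0.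
  - by rewrite meval1; apply/eqP/oner_neq0.
  - by move=> x y /=; rewrite mevalM => /eqP; rewrite mulf_eq0 => /orP[]/eqP; [left|right].
have [[[p0 Zp0] _] _] := Zirr 0%N (leq0n k).
have Psub i : (i < k.+1)%N -> P i.+1 `<=` P i.
  case: i => [|i] ik g Pg.
    rewrite /P /= -[RHS](Pg p0 0 Zp0); apply: meval_eq => i; by rewrite mul0r.
  by move=> p t Zp; apply: Pg; have [+ _] := Zlt i ik; apply.
have /choice[f fP] (i : 'I_k.+1) : exists g, P i g /\ ~ P i.+1 g.
  case: i => [[|i] ik].
    have [j pj] := hcoord_neq0 p0; exists 'X_j; split; rewrite /P /=.
      by rewrite mevalXU.
    by move/(_ p0 1 Zp0); rewrite mevalXU mul1r; apply/eqP.
  have [[p1 Zp1] _] := (Zirr i (ltnW ik)).1.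
  have [_ [_ [S Sh ->] ZE]] := Zirr i (ltnW ik).
  have [sub nsub] := Zlt i ik.
  have [p [Zp nZp]] : exists p, Z i.+1 p /\ ~ Z i p.
    by apply: contrapT => H; apply: nsub => p Zp; apply: contrapT => nZp; apply: H; exists p.
  (* Since [p] lies in [T], it must be off the closed set that cuts out [Z i], and one equation of
     that set separates it. *)
  have Tp : T p by have [_ [F _ FE]] := Zirr i.+1 ik; move: Zp; rewrite FE => -[].
  have [g [Sg gp]] : exists g, S g /\ g.@[hcoord p] != 0.
    apply: contrapT => H; apply: nZp; rewrite ZE; split=> // g Sg.
    by apply: contrapT => /eqP gp; apply: H; exists g.
  have [e ge] := Sh g Sg; exists g; split; rewrite /P /=.
    move=> q t; rewrite ZE => -[/(_ g Sg) gq _].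
    by rewrite (meval_homogZ _ _ ge) gq mulr0.
  move/(_ p 1 Zp); rewrite (meval_homogZ _ _ ge) expr1n mul1r.
  exact/eqP.
exists f => F; apply: (@prime_chain_independent K B k.+1 (subst f) P).
- by case=> [|i] ik //; apply: cone_ideal_prime; have [] := Zirr i ik.
- exact: Psub.
- by move=> i; rewrite /= substX.
Qed.

End ConeIdeal.

Theorem lemma2p1 (K : closedFieldType) (charK : [pchar K] =i pred0)
    (n r d : nat) (hs : 'I_r -> {mpoly K[n.+1]}) (h : {mpoly K[n.+1]})
    (s : int)
    (hs_homog : forall i, exists2 e : nat, (e < d)%N & hs i \is e.-homog)
    (h_homog : h \is d.-homog)
    (dim_sing : dim_eq (singular_locus h) s) :
  dim_le (tangency_locus h (range hs)) (r%:Z + s).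
Proof.
have [dims _] := dim_sing; have s1 := dims.1.
split=> [|k Z chainZ]; first by lia.
have /choice[e eP] i : exists e, (e < d)%N /\ hs i \is e.-homog.
  by have [e] := hs_homog i; exists e.
have [c [y [cs y1 fin]]] := singular_locus_parameters h_homog dims.
suff : (k < r + c)%N by lia.
rewrite ltnNge; apply/negP => krc.
(* Asking for [d < M] keeps the differences [M - jacobian_deg d j] from being truncated. *)
have [M dM HM] := finite_over_spanned (jacobian_homog h_homog) y1 d fin.
pose Om := {va : ('I_n.+1 -> K) * ('I_r -> K) | forall j,
  (jacobian h j).@[va.1] = \sum_i va.2 i * (jacobian (hs i) j).@[va.1]}.
pose v (w : Om) := (sval w).1; pose a (w : Om) := (sval w).2.
pose z (w : Om) (l : 'I_(r + c)) :=
  match split l with inl i => a w i | inr j => (y j).@[v w] end.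
(* Here [deg h_i < d] enters: replacing a generator for [h] by the one for [hs i] lowers the degree
   by at least one. *)
have sz i j : (msize (jacobian (hs i) j) <= jacobian_deg d j)%N.
  have [ed hi] := eP i; have := msize_homog hi.
  case: j => [l|] /= hd; last exact: leq_trans ed.
  by apply: leq_trans (msize_mderiv _ _) _; lia.
have [f find] := irr_chain_independent chainZ.
have [|Q /eqP Q0 QZ] := @reduction_algebraic K n.+1 (r + c) Om v z M _ k.+1 f krc.
  (* On [Om] each [jacobian h j] is the combination of the [jacobian (hs i) j] with coefficients
     [a w i]; collecting the terms by [i] gives the coefficient of each parameter. *)
  move=> m /HM[q [q' [XE qM q'M]]].
  exists (fun l => match split l with
    | inl i => \sum_j q j * jacobian (hs i) j | inr l => q' l end) => [l|w].
    case: split => [i|l'] //; apply: (big_ind (fun g => msize g <= M)%N).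
    - by rewrite msize0.
    - by move=> g1 g2 M1 M2; rewrite (leq_trans (mmeasureD_le _ _ _)) // geq_max M1.
    move=> j _; have [->|q0] := eqVneq (q j) 0; first by rewrite mul0r msize0.
    have [->|g0] := eqVneq (jacobian (hs i) j) 0; first by rewrite mulr0 msize0.
    rewrite msizeM //; move: (qM j) (sz i j) g0; rewrite -(mmeasure_poly_eq0 mdeg).
    have : (jacobian_deg d j <= d)%N by rewrite /jacobian_deg; case: (j) => [_|];
      rewrite ?leq_pred.
    move: (msize _) (msize _) (jacobian_deg _ _) => m1 m2 m3.
    lia.
  rewrite XE mevalD !rmorph_sum big_split_ord /=; congr (_ + _); last first.
    apply: eq_bigr => l _; rewrite /z; case: splitP => [i /= E|l' /= /addnI/val_inj <-].
      by have := ltn_ord i; rewrite -E ltnNge leq_addr.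
    by rewrite mevalM mulrC.
  rewrite (eq_bigr (fun j => \sum_i a w i * ((q j).@[v w] * (jacobian (hs i) j).@[v w])));
    last first.
    move=> j _; rewrite mevalM [(jacobian h j).@[_]](svalP w j) mulr_sumr.
    by apply: eq_bigr => i _; rewrite mulrCA.
  rewrite exchange_big; apply: eq_bigr => i _; rewrite -mulr_sumr /z.
  case: splitP => [i' /= /val_inj <-|l /= E].
    by rewrite rmorph_sum; congr (_ * _); apply: eq_bigr => j _; rewrite /= mevalM.
  by have := ltn_ord i; rewrite E ltnNge leq_addr.
(* The multipliers lift every point of the cone over [Z k] to [Om], so the relation [Q] holds on
   that cone and contradicts independence. *)
apply: Q0; apply: find => p t Zp; rewrite meval_subst.
have Tp : tangency_locus h (range hs) p.
  by have [_ [F _ FE]] := chainZ.1 k (leqnn k); move: Zp; rewrite FE => -[].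
have [b [b1 b2]] := tangency_multipliers (fun i => (eP i).1) (fun i => (eP i).2) h_homog t Tp.
have bP j : (jacobian h j).@[fun i => t * hcoord p i] =
  \sum_i b i * (jacobian (hs i) j).@[fun i => t * hcoord p i] by case: j.
exact: (QZ (exist _ (_, b) bP)).
Qed.
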